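(* Let $a$ be a reduced lift and let $\{\mathfrak v_n\}_{n\in\mathcal N}$ be admissible for $(a,\kappa)$ for some $\kappa\ge0$. Then: (a) The set $\overline{\mathcal M}_a$ is the disjoint union $$\overline{\mathcal M}_a=\bigsqcup_{\ell\in\mathcal M^-_{a,\emptyset}}\big(\ell+\mathbb Z_{\ge0}\langle\mathfrak v_n\rangle_{n\in\mathcal N}\big).$$ (b) The set of holes is $$\overline{\mathcal M}_a\setminus\mathcal M_a=\bigcup_{n\in\mathcal N}\Big(\bigsqcup_{\ell\in\mathcal M^-_{a,\{n\}}}(\ell+F_{\{n\}})\Big),$$ where for every nonempty $\mathcal I\subseteq\mathcal N$ $$\bigcap_{n\in\mathcal I}\Big(\bigsqcup_{\ell\in\mathcal M^-_{a,\{n\}}}(\ell+F_{\{n\}})\Big)=\bigsqcup_{\ell\in\mathcal M^-_{a,\mathcal I}}(\ell+F_{\mathcal I}).$$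
   Context: **Graph and lattices.** $\Gamma$ is a connected negative definite plumbing tree with vertex set $\mathcal V$, all genera $0$, integer decorations $b_v$, which is the dual graph of the minimal good resolution of a normal surface singularity (so $b_v\le -2$ whenever the valency $\delta_v\le 2$). $L=\bigoplus_{v\in\mathcal V}\mathbb Z E_v$ has the negative definite form $(E_v,E_v)=b_v$, $(E_v,E_w)=1$ if $v\neq w$ are adjacent, $0$ otherwise. $L'=\{l'\in L\otimes\mathbb Q:(l',L)\subset\mathbb Z\}\supset L$ is freely generated by $E_v^*$, where $(E_v^*,E_w)=-1$ if $v=w$ and $0$ otherwise. **Nodes and Seifert invariants.** $\mathcal N=\{n:\delta_n\ge 3\}$ is the set of nodes (assumed nonempty), $\mathcal E=\{u:\delta_u=1\}$ the set of ends. For $n\in\mathcal N$, $\mathcal N_n$ is the set of nodes $n'\ne n$ such that the path from $n$ to $n'$ has no node in its interior $(n,n')$ (neighbouring nodes); $\mathcal E_n$ is the set of ends $u$ such that the path $(n,u]$ ($n$ excluded) contains no node. For a full subgraph, $\det$ denotes the determinant of the negative of its intersection matrix ($1$ for the empty graph). For $u\in\mathcal E_n$: $\alpha_u=\det_{(n,u]}$ and $\omega_u$ is the determinant of $(n,u]$ with the vertex adjacent to $n$ deleted. For $n'\in\mathcal N_n$: $\alpha_{n,n'}=\alpha_{n',n}=\det_{(n,n')}$ and $\omega_{n,n'}$ is the determinant of $(n,n')$ with the vertex adjacent to $n$ deleted; if $(n,n')=\emptyset$ put $\alpha_{n,n'}=1$, $\omega_{n,n'}=0$. **Reduced lifts.**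 For each pair of neighbouring nodes fix an order $n<n'$ or $n'<n$; sums over $n'>n$ or $n'<n$ run over neighbouring nodes $n'\in\mathcal N_n$, and ''$n<n'$'' always refers to neighbouring nodes. For $n<n'$, $n_{n'}$ is the vertex adjacent to $n$ on the path from $n$ to $n'$ ($n_{n'}=n'$ if $(n,n')=\emptyset$). A reduced lift is an element $a=\sum_{n\in\mathcal N}a_nE_n^*+\sum_{u\in\mathcal E}a_uE_u^*+\sum_{n<n'}a_{n_{n'}}E^*_{n_{n'}}\in L'$, given with its integer coefficients (coefficient $a_{n_{n'}}$ is kept separate from $a_{n'}$ if $(n,n')=\emptyset$). $\pi_{\mathcal N}:\mathbb R\langle E_v\rangle_{v\in\mathcal V}\to\mathbb R\langle E_n\rangle_{n\in\mathcal N}$ is the coordinate projection and $\mathbf c_a:=\pi_{\mathcal N}(a)$. **Sets attached to $a$.** $\mathbb Z^{\mathcal N}(a)=\{\ell=\sum_{n\in\mathcal N}\ell_nE_n:\ \ell_n\in\mathbb Z,\ \ell_n+\omega_{n',n}\ell_{n'}\equiv a_{n_{n'}}\ (\mathrm{mod}\ \alpha_{n,n'})\ \forall\, n<n'\}$. For $n\in\mathcal N$, $$N_a(\ell,n)=a_n+\sum_{n'>n}\frac{\omega_{n,n'}}{\alpha_{n,n'}}a_{n_{n'}}+\sum_{n'<n}\frac{1}{\alpha_{n,n'}}a_{n'_n}-\Big(b_n+\sum_{n'\in\mathcal N_n}\frac{\omega_{n,n'}}{\alpha_{n,n'}}\Big)\ell_n-\sum_{n'\in\mathcal N_n}\frac{\ell_{n'}}{\alpha_{n,n'}}+\sum_{u\in\mathcal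 E_n}\Big\lfloor\frac{a_u-\omega_u\ell_n}{\alpha_u}\Big\rfloor,$$ $\overline N_a(\ell,n)=N_a(\ell,n)+\sum_{u\in\mathcal E_n}\{(a_u-\omega_u\ell_n)/\alpha_u\}$ ($\{\cdot\}$ is the fractional part). $\mathcal M_a=\{\ell\in\mathbb Z^{\mathcal N}(a):N_a(\ell,n)\ge 0\ \forall n\in\mathcal N\}$, and its normalization is $\overline{\mathcal M}_a=\{\ell\in\mathbb Z^{\mathcal N}(a):\overline N_a(\ell,n)\ge 0\ \forall n\in\mathcal N\}$. $\mathcal C^{orb}=\pi_{\mathcal N}(\mathcal S'_{\mathbb R})$, where $\mathcal S'_{\mathbb R}=\{l\in L\otimes\mathbb R:(l,E_v)\le 0\ \forall v\in\mathcal V\}$. **Admissible vectors.** A family $\{\mathfrak v_n\}_{n\in\mathcal N}\subset\mathcal M_0$ is called admissible for $(a,\kappa)$, with $a$ a reduced lift and $\kappa\ge 0$, if $\mathbb R_{\ge0}\langle\mathfrak v_n\rangle_{n\in\mathcal N}=\mathcal C^{orb}$ and for all $\ell\in\overline{\mathcal M}_a$, $n\in\mathcal N$: $N_a(\ell+\mathfrak v_n,n')=N_a(\ell,n')$ for all nodes $n'\ne n$, and $N_a(\ell+\mathfrak v_n,n)\ge\kappa$. Given such vectors, $\Box=\sum_{n\in\mathcal N}[0,1)\mathfrak v_n$, and for $\mathcal I\subseteq\mathcal N$: $\mathcal M^-_{a,\mathcal I}=\{\ell\in(\Box-\mathbf c_a)\cap\mathbb Z^{\mathcal N}(a):N_a(\ell,n)<0\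 \forall n\in\mathcal I\}$ (so $\mathcal M^-_{a,\emptyset}=(\Box-\mathbf c_a)\cap\mathbb Z^{\mathcal N}(a)$), and $F_{\mathcal I}=\mathbb Z_{\ge0}\langle\mathfrak v_{n'}\rangle_{n'\in\mathcal N\setminus\mathcal I}$. *)

(* Defs.v *)
From HB Require Import structures.
From mathcomp Require Import all_boot all_order all_algebra.
From mathcomp Require Import all_classical.
From mathcomp Require Import reals.

Set Implicit Arguments.
Unset Strict Implicit.
Unset Printing Implicit Defensive.

Import Order.TTheory GRing.Theory Num.Theory.
Local Open Scope ring_scope.

(* Plumbing graphs.  All genera are 0, so no genus decoration is recorded.    *)
Record plumbing_graph := PlumbingGraph {
  vertex :> finType;
  adj : rel vertex;
  deco : vertex -> int;
  adj_sym : symmetric adj;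
  adj_irr : irreflexive adj }.

Section Graph.
Variable G : plumbing_graph.
Implicit Types (u v w : G) (A : {set G}).

Definition valency v : nat := #|[set w | adj v w]|.

Definition connected_graph : Prop := forall v w, connect (@adj G) v w.

Definition acyclic : Prop :=
  forall c : seq G, (2 < size c)%N -> ~ ucycle (@adj G) c.

Definition eform v w : int := if v == w then deco v else (adj v w)%:R.

(* Bilinear extension of the form to L (R := int) and to L (x) R; an element  *)
(* is identified with its coordinates in the basis (E_v)_v.                   *)
Definition pairing (R : pzRingType) (x y : {ffun G -> R}) : R :=
  \sum_v \sum_w x v * (eform v w)%:~R * y w.

Definition Evec (R : pzRingType) v : {ffun G -> R} := [ffun w => (w == v)%:R].

Definition negative_definite : Prop :=
  forall x : {ffun G -> int}, x != 0 -> pairing x x < 0.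

(* Minimality of the good resolution with dual graph G.                       *)
Definition minimal_good : Prop :=
  forall v, (valency v <= 2)%N -> deco v <= - 2%:Z.

Definition fullmx A : 'M[int]_#|A| :=
  \matrix_(i, j) eform (enum_val i) (enum_val j).

(* For A empty this is the determinant of a 0 x 0 matrix, that is 1.          *)
Definition detg A : int := \det (- fullmx A).

(* Vertices of the path from v to w, both included (in a tree the simple path *)
(* from v to w is unique).                                                    *)
Definition tpath v w : {set G} :=
  [set x | `[< exists p : seq G, [/\ path (@adj G) v p, uniq (v :: p),
                                     last v p = w & x \in v :: p] >]].

Definition path_oo v w : {set G} := tpath v w :\: [set v; w].
Definition path_oc v w : {set G} := tpath v w :\ v.

(* For v != w: the neighbour of v on the path from v to w.                    *)
Definition toward v w : G := odflt v [pick x in tpath v w | adj v x].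

Definition del_adjacent v A : {set G} := [set x in A | ~~ adj v x].

End Graph.

Record node (G : plumbing_graph) :=
  Node { node_vertex :> G; _ : (2 < valency node_vertex)%N }.
HB.instance Definition _ (G : plumbing_graph) := [isSub for @node_vertex G].
HB.instance Definition _ (G : plumbing_graph) := [Finite of node G by <:].

Record leaf (G : plumbing_graph) :=
  Leaf { leaf_vertex :> G; _ : valency leaf_vertex == 1%N }.
HB.instance Definition _ (G : plumbing_graph) := [isSub for @leaf_vertex G].
HB.instance Definition _ (G : plumbing_graph) := [Finite of leaf G by <:].

Section Seifert.
Variable G : plumbing_graph.
Implicit Types v w : G.
Local Notation node := (node G).
Local Notation leaf := (leaf G).

(* n' is in N_n: n and n' are neighbouring nodes. *)
Definition nbr (n n' : node) : bool :=
  (n' != n) && [forall m : node, (m : G) \notin path_oo n n'].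

(* u is in E_n. *)
Definition leaf_of (n : node) (u : leaf) : bool :=
  [forall m : node, (m : G) \notin path_oc n u].

(* alpha_u and omega_u; they are only used for u \in E_n, and n is then       *)
(* determined by u.                                                           *)
Definition alpha_leaf (n : node) (u : leaf) : int := detg (path_oc n u).
Definition omega_leaf (n : node) (u : leaf) : int :=
  detg (del_adjacent n (path_oc n u)).

Definition alpha (n n' : node) : int := detg (path_oo n n').
Definition omega (n n' : node) : int :=
  if path_oo n n' == finset.set0 then 0
  else detg (del_adjacent n (path_oo n n')).

(* One order n < n' or n' < n is fixed for each pair of neighbouring nodes,   *)
(* independently of the other pairs (in particular, no transitivity).         *)
Definition pair_ordering (ord : rel node) : Prop :=
  forall n n', nbr n n' -> ord n n' = ~~ ord n' n.

Definition nlt (ord : rel node) (n n' : node) : bool := nbr n n' && ord n n'.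

(* Integer coefficients of a reduced lift.  rl_edge a n n' is the coefficient *)
(* a_{n_{n'}}, kept separate from a_{n'} when n_{n'} = n'; only its values at *)
(* n < n' are ever used.                                                      *)
Record reduced_lift := ReducedLift {
  rl_node : node -> int;
  rl_leaf : leaf -> int;
  rl_edge : node -> node -> int }.

Definition zero_lift : reduced_lift :=
  ReducedLift (fun=> 0) (fun=> 0) (fun _ _ => 0).

Section Lattice.
Variable R : realType.

Definition form_mx : 'M[R]_#|G| :=
  \matrix_(i, j) (eform (enum_val i) (enum_val j))%:~R.

(* E_v^*, in L (x) R: the v-th row of minus the inverse of the form.          *)
Definition Estar v : {ffun G -> R} :=
  [ffun w => - invmx form_mx (enum_rank v) (enum_rank w)].

Lemma pairing_Estar v w : form_mx \in unitmx ->
  pairing (Estar v) (Evec R w) = - (v == w)%:R.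
Proof.
move=> Iu.
have := congr1 (fun M : 'M[R]_#|G| => M (enum_rank v) (enum_rank w))
               (mulVmx Iu).
rewrite !mxE (inj_eq enum_rank_inj) => <-; rewrite -sumrN /pairing.
rewrite (reindex (fun i : 'I_#|G| => enum_val i)) /=; last first.
  by exists enum_rank => i _; rewrite ?enum_valK ?enum_rankK.
apply: eq_bigr => i _; rewrite (bigD1 w) //= big1 => [|x xw].
  by rewrite !ffunE !mxE eqxx addr0 mulr1 enum_valK enum_rankK mulNr.
by rewrite [Evec _ _ _]ffunE (negPf xw) mulr0.
Qed.

Definition lift_vec (ord : rel node) (a : reduced_lift) : {ffun G -> R} :=
  \sum_(n : node) Estar n *~ rl_node a n
  + \sum_(u : leaf) Estar u *~ rl_leaf a u
  + \sum_(p : node * node | nlt ord p.1 p.2)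
      Estar (toward p.1 p.2) *~ rl_edge a p.1 p.2.

Definition proj_nodes (x : {ffun G -> R}) : {ffun node -> R} :=
  [ffun n : node => x (n : G)].

Definition c_vec ord a : {ffun node -> R} := proj_nodes (lift_vec ord a).

(* Real coordinates of an element of Z<E_n>. *)
Definition toR (l : {ffun node -> int}) : {ffun node -> R} :=
  [ffun n => (l n)%:~R].

Definition N_base (ord : rel node) (a : reduced_lift)
    (l : {ffun node -> int}) (n : node) : R :=
  (rl_node a n)%:~R
  + \sum_(n' | nlt ord n n')
      (omega n n')%:~R / (alpha n n')%:~R * (rl_edge a n n')%:~R
  + \sum_(n' | nlt ord n' n) (alpha n n')%:~R^-1 * (rl_edge a n' n)%:~R
  - ((deco n)%:~R
     + \sum_(n' | nbr n n') (omega n n')%:~R / (alpha n n')%:~R) * (l n)%:~R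
  - \sum_(n' | nbr n n') (l n')%:~R / (alpha n n')%:~R.

Definition leaf_quot (a : reduced_lift) (l : {ffun node -> int}) (n : node)
    (u : leaf) : R :=
  (rl_leaf a u - omega_leaf n u * l n)%:~R / (alpha_leaf n u)%:~R.

Definition N_fun ord a l n : R :=
  N_base ord a l n + \sum_(u | leaf_of n u) (Num.floor (leaf_quot a l n u))%:~R.

Definition fract (x : R) : R := x - (Num.floor x)%:~R.

Definition Nbar_fun ord a l n : R :=
  N_fun ord a l n + \sum_(u | leaf_of n u) fract (leaf_quot a l n u).

End Lattice.
End Seifert.

Local Open Scope classical_set_scope.

Section Sets.
Variables (R : realType) (G : plumbing_graph) (ord : rel (node G)).
Implicit Types (a : reduced_lift G) (v : node G -> {ffun node G -> int}).

Definition ZN a : set {ffun node G -> int} :=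
  [set l | forall n n', nlt ord n n' ->
     (l n + omega n' n * l n' = rl_edge a n n' %[mod alpha n n'])%Z].

Definition M_set a : set {ffun node G -> int} :=
  [set l | ZN a l /\ forall n, 0 <= N_fun R ord a l n].

Definition Mbar_set a : set {ffun node G -> int} :=
  [set l | ZN a l /\ forall n, 0 <= Nbar_fun R ord a l n].

Definition lipman_cone : set {ffun G -> R} :=
  [set x | forall v : G, pairing x (Evec R v) <= 0].

Definition C_orb : set {ffun node G -> R} := @proj_nodes G R @` lipman_cone.

Definition real_comb v (c : {ffun node G -> R}) : {ffun node G -> R} :=
  [ffun m => \sum_n c n * (v n m)%:~R].

Definition real_cone v : set {ffun node G -> R} :=
  real_comb v @` [set c : {ffun node G -> R} | forall n, 0 <= c n].

Definition box v : set {ffun node G -> R} :=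
  real_comb v @` [set c : {ffun node G -> R} | forall n, 0 <= c n < 1].

Definition nat_span v (A : {set node G}) : set {ffun node G -> int} :=
  [set \sum_(n in A) v n *+ k n | k in [set: {ffun node G -> nat}]].

Definition translate (l : {ffun node G -> int})
    (X : set {ffun node G -> int}) : set {ffun node G -> int} :=
  [set l + x | x in X].

Definition admissible a (kappa : R) v : Prop :=
  [/\ forall n, M_set (zero_lift G) (v n),
      real_cone v = C_orb
    & forall l n, Mbar_set a l ->
        (forall n', n' != n ->
           N_fun R ord a (l + v n) n' = N_fun R ord a l n') /\
        kappa <= N_fun R ord a (l + v n) n].

(* The condition l \in Box - c_a is written as l + c_a \in Box.               *)
Definition M_minus a v (I : {set node G}) : set {ffun node G -> int} :=
  [set l | [/\ ZN a l, box v (toR R l + c_vec R ord a)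
             & forall n, n \in I -> N_fun R ord a l n < 0]].

Definition F_face v (I : {set node G}) : set {ffun node G -> int} :=
  nat_span v (~: I)%SET.

End Sets.

Definition is_disjoint_union (T J : Type) (X : set T) (D : set J)
    (F : J -> set T) : Prop :=
  X = \bigcup_(i in D) F i /\ trivIset D F.

(* Main.v *)
From HB Require Import structures.
Require Import Defs.
From mathcomp Require Import all_boot all_order all_algebra.
From mathcomp Require Import all_fingroup.
From mathcomp Require Import all_classical.
From mathcomp Require Import reals.
From mathcomp Require Import zify ring lra.

Set Implicit Arguments.
Unset Strict Implicit.
Unset Printing Implicit Defensive.

Import Order.TTheory GRing.Theory Num.Theory.
Local Open Scope ring_scope.

(** Write pi for the coordinate projection to the nodes.  The point is that the
    normalized counting function is linear once its origin is moved to -c_a: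
    Nbar_a(l, n) = Lambda_n(l + c_a), where -Lambda_n is the n-th row of the
    orbifold intersection form on the node coordinates
    ([Nbar_orb_form]).  To see this, pair the lift vector x with the E_v.  By
    definition of the E*_v this gives, at every vertex v, the balance
    -b_v x_v = (sum of x over the neighbours of v) + (coefficient of a at v)
    ([lift_balanced]).  Along a chain of vertices of valency 2 the balance is a
    three-term recursion, solved by the continuants of the chain, which are the
    Seifert invariants ([three_term_solve], [detseq_rec]).  So the value of x
    next to a node n, on the way to a neighbouring node or to an end, is
    expressed by alpha, omega and the values at both extremities ([nbr_value],
    [leg_value]); since the edges at n correspond to the neighbouring nodes and
    to the legs of n ([sum_adj_node]), the balance at n becomes the formula.

    Applied to a = E*_n, the formula says that the vectors pi(E*_n) of the
    orbifold cone form a basis dual to the Lambda_m ([orb_form_node_lift]), so a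
    vector of node coordinates is determined by its values under the Lambda_m
    ([orb_form_inj]).  If some l lies in the normalization, so do all l + j v_n,
    and N_a(l + j v_n, m) does not change for m <> n; as Nbar_a - N_a is bounded,
    Lambda_m(v_n) = 0 ([orb_form_v_other]).  Since the v_n generate a cone that
    contains pi(E*_n), the number mu_n = Lambda_n(v_n) is positive.  Hence the
    half-open box is given by 0 <= Lambda_n < mu_n ([box_itv]), and everything
    is phrased in terms of the numbers Nbar_a(l, n) and N_a(l, n).

    What remains is Euclidean division by the mu_n.  Subtracting
    floor(Nbar_a(l, n) / mu_n) copies of each v_n brings l into the box in a
    unique way.  If a copy of v_n was used then N_a(l, n) >= kappa >= 0,
    otherwise N_a(l, n) is the value at the reduced point; so the points with
    N_a(l, n) < 0 for all n in a set J are the translates, by the face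
    complementary to J, of the reduced points with this property ([face_holes],
    [M_minus_faces]).  All parts of the theorem are instances: J empty, J a
    singleton, and J arbitrary for the intersections.  When no l satisfies the
    congruences all sets are empty. *)

(** * Determinants of subgraphs *)

Section Determinants.
Variable G : plumbing_graph.

(** Indexed by a function rather than a set, so that the same matrix serves a set
    listed in any order, and rows can be peeled off a list. *)
Definition form_of k (f : 'I_k -> G) : 'M[int]_k :=
  \matrix_(i, j) eform (f i) (f j).

(** Both matrices are indexed by the same vertices, so they are conjugate by a
    permutation matrix, whose sign is squared. *)
Lemma det_form_reindex k l (f : 'I_k -> G) (g : 'I_l -> G) :
    injective f -> injective g -> (codom f =i codom g) ->
  \det (- form_of f) = \det (- form_of g).
Proof.
move=> fI gI fg.
have kl : k = l.
  rewrite -[k]card_ord -[l]card_ord -(card_codom fI) -(card_codom gI).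
  exact: eq_card.
case: _ / kl g gI fg => g gI fg.
have gf i : g i \in codom f by rewrite fg codom_f.
pose s i := iinv (gf i).
have fs i : f (s i) = g i by rewrite f_iinv.
have sI : injective s by move=> i j sij; apply: gI; rewrite -!fs sij.
pose p := perm sI.
have -> : - form_of g = row_perm p (col_perm p (- form_of f)).
  by apply/matrixP => i j; rewrite !mxE !permE !fs.
rewrite row_permE col_permE !det_mulmx !det_perm odd_permV.
by rewrite mulrCA -signr_addb addbb mulr1.
Qed.

Definition detseq (s : seq G) : int := \det (- form_of (tnth (in_tuple s))).

Lemma detg_seq (s : seq G) (A : {set G}) : uniq s -> A =i s -> detg A = detseq s.
Proof.
move=> us As; rewrite /detg /detseq.
have -> : fullmx A = form_of (enum_val (A := A)) by [].
apply: det_form_reindex; first exact: enum_val_inj.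
- by apply/tuple_uniqP.
- move=> x; apply/codomP/codomP => [[i ->]|[i ->]].
  + have : enum_val i \in in_tuple s by rewrite -As enum_valP.
    by move=> /tnthP [j ->]; exists j.
  + have tA : tnth (in_tuple s) i \in A by rewrite As mem_tnth.
    by exists (enum_rank_in tA (tnth (in_tuple s) i)); rewrite enum_rankK_in.
Qed.

Lemma cofactor00 k (A : 'M[int]_k.+1) :
  cofactor A ord0 ord0 = \det (row' ord0 (col' ord0 A)).
Proof. by rewrite /cofactor expr0 mul1r. Qed.

Lemma detseq0 : detseq [::] = 1.
Proof. by rewrite /detseq det_mx00. Qed.

Lemma detseq1 x : detseq [:: x] = - deco x.
Proof. by rewrite /detseq det_mx11 !mxE /eform eqxx. Qed.

(** The continuant recursion: the first row of the matrix has only the entries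
    -b_x and -1, so expanding along it, and then the second minor along its first
    column, leaves two terms. *)
Lemma detseq_rec (x y : G) s : adj x y -> uniq [:: x, y & s] ->
   {in s, forall z, ~~ adj x z} ->
  detseq [:: x, y & s] = - deco x * detseq (y :: s) - detseq s.
Proof.
move=> xy /= /andP[]; rewrite inE negb_or => /andP[neq_xy xs] /andP[ys us] xzs.
(* Beyond [y], the first row and the first column vanish. *)
have far z : z \in s -> eform x z = 0 /\ eform z x = 0.
  move=> zs; have xz : x != z by apply: contraNneq xs => ->.
  by rewrite /eform (eq_sym z) (negPf xz) (adj_sym z) (negPf (xzs z zs)).
have tn (z : G) (t : seq G) (i : 'I_(size t)) :
    tnth (in_tuple (z :: t)) (lift ord0 i) = tnth (in_tuple t) i.
  by rewrite !(tnth_nth z).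
have l01 : lift (lift ord0 ord0) (ord0 : 'I_(size (y :: s)))
    = ord0 :> 'I_(size [:: x, y & s]) by apply: val_inj.
rewrite [LHS](expand_det_row _ ord0) big_ord_recl big_ord_recl big1 ?addr0; last first.
  move=> i _; rewrite !mxE tn tn.
  have := far (tnth (in_tuple s) i) (mem_tnth _ _) => -[-> _].
  by rewrite oppr0 mul0r.
rewrite !mxE !tn {1}/eform eqxx; congr (_ * _ + _).
  rewrite cofactor00; congr (\det _).
  by apply/matrixP => i j; rewrite !mxE !tn.
have -> : tnth (in_tuple (y :: s)) ord0 = y by [].
have -> : tnth (in_tuple [:: x, y & s]) ord0 = x by [].
rewrite /eform (negPf neq_xy) xy mulN1r; congr (- _).
rewrite /cofactor expr1 (expand_det_col _ ord0) big_ord_recl big1 ?addr0; last first.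
  move=> i _; rewrite !mxE.
  rewrite l01 !tn.
  have := far (tnth (in_tuple s) i) (mem_tnth _ _) => -[_].
  have -> : tnth (in_tuple [:: x, y & s]) ord0 = x by [].
  by move=> ->; rewrite oppr0 mul0r.
rewrite !mxE l01 !tn.
have -> : tnth (in_tuple (y :: s)) ord0 = y by [].
have -> : tnth (in_tuple [:: x, y & s]) ord0 = x by [].
rewrite /eform eq_sym (negPf neq_xy) adj_sym xy mulN1r mulN1r opprK cofactor00.
congr (\det _); apply/matrixP => i j; rewrite !mxE.
have -> : lift (lift ord0 ord0) (lift ord0 j)
    = lift ord0 (lift ord0 j) :> 'I_(size [:: x, y & s]).
  by apply: val_inj.
by rewrite !tn.
Qed.

(** A vector in the kernel of the matrix, which may be taken integral, extends by
    zero to an element of the lattice with self-intersection 0. *)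
Lemma det_form_neq0 k (f : 'I_k -> G) : negative_definite G -> injective f ->
  \det (form_of f) != 0.
Proof.
move=> neg fI; apply/negP => /det0P [u u0 uM].
pose x : {ffun G -> int} := [ffun v => \sum_(i | f i == v) u 0 i].
have xf i : x (f i) = u 0 i.
  rewrite ffunE (bigD1 i) //= big1 ?addr0 // => j /andP[/eqP /fI -> ].
  by rewrite eqxx.
have x0 : x != 0.
  apply: contraNneq u0 => x0; apply/eqP/rowP => i.
  by rewrite -xf x0 !mxE ffunE.
have := neg x x0; rewrite /pairing.
have sumx (h : G -> int) : \sum_v x v * h v = \sum_i u 0 i * h (f i).
  under eq_bigr => v _ do rewrite ffunE big_distrl /=.
  rewrite (exchange_big_dep xpredT) //=; apply: eq_bigr => i _.
  by rewrite (big_pred1 (f i)) // => v; rewrite eq_sym.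
have -> : \sum_v \sum_w x v * (eform v w)%:~R * x w = 
    \sum_j (u *m form_of f) 0 j * u 0 j.
  transitivity (\sum_v x v * \sum_w x w * eform v w).
    apply: eq_bigr => v _; rewrite mulr_sumr; apply: eq_bigr => w _.
    by rewrite intz -mulrA (mulrC (eform _ _)).
  rewrite sumx; under eq_bigr => i _ do rewrite sumx mulr_sumr.
  rewrite exchange_big /=; apply: eq_bigr => j _; rewrite mxE mulr_suml.
  by apply: eq_bigr => i _; rewrite mxE; ring.
by rewrite big1 // => j _; rewrite uM mxE mul0r.
Qed.

Lemma detg_neq0 (A : {set G}) : negative_definite G -> detg A != 0.
Proof.
move=> neg; rewrite /detg -scaleN1r detZ mulf_neq0 ?signr_eq0 //.
by apply: (det_form_neq0 (f := enum_val (A := A))) => //; exact: enum_val_inj.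
Qed.

Lemma form_mx_unit (R : realType) : negative_definite G -> form_mx G R \in unitmx.
Proof.
move=> neg.
have -> : form_mx G R = map_mx intr (form_of (@enum_val G predT)).
  by apply/matrixP => i j; rewrite !mxE.
rewrite unitmxE det_map_mx unitfE intr_eq0 det_form_neq0 //.
Qed.

End Determinants.

(** * Simple paths and chains in a tree *)

Section Trees.
Variable G : plumbing_graph.
Hypothesis acy : acyclic G.
Implicit Types (n v w x z : G) (p q : seq G).
Local Notation e := (@adj G).

(** Removing a vertex of a tree separates its neighbours: otherwise a simple path
    between two of them, closed up at the vertex, is a cycle. *)
Lemma nbr_disconnected n w w' p : e n w -> e n w' -> path e w p ->
  last w p = w' -> n \notin w :: p -> w = w'.
Proof.
move=> nw nw' wp; case/shortenP: wp => p' wp' up' sub_p' lst nwp.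
apply: contraTeq nwp => ww'; apply/negP => nwp.
have nwp' : n \notin w :: p'.
  by apply: contraNN nwp; rewrite !inE => /orP[->//|/sub_p' ->]; rewrite orbT.
case: p' wp' up' {sub_p'} lst nwp' => [_ _ /= E|x p' wp' up' lst nwp'].
  by rewrite E eqxx in ww'.
case: (acy (c := [:: n, w, x & p'])) => //.
apply/andP; split; last by rewrite cons_uniq nwp' up'.
move: wp' lst; rewrite /= rcons_path nw => /andP[-> ->] ->.
by rewrite adj_sym.
Qed.

(** By induction it suffices to compare the first steps; they are neighbours of
    the origin joined by a path (out along one, back along the other) avoiding it. *)
Lemma simple_path_unique n p q : path e n p -> uniq (n :: p) ->
  path e n q -> uniq (n :: q) -> last n p = last n q -> p = q.
Proof.
elim: p n q => [|x p IH] n [|y q] //=.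
- by move=> _ _ _ /andP[nyq _] E; rewrite E mem_last in nyq.
- by move=> _ /andP[nxp _] _ _ E; rewrite -E mem_last in nxp.
move=> /andP[nx xp] /andP[nxp uxp] /andP[ny yq] /andP[nyq uyq] E.
have xy : x = y.
  apply: (@nbr_disconnected n x y (p ++ rev (belast y q))) => //.
  - rewrite cat_path xp /= E rev_path.
    by rewrite (@eq_path _ _ e) // => a b; exact: adj_sym.
  - rewrite last_cat; case: q {IH yq uyq ny nyq} E => [//|a q] _ /=.
    by rewrite rev_cons last_rcons.
  - rewrite -cat_cons mem_cat negb_or nxp mem_rev /=.
    by apply: contraNN nyq => /mem_belast.
by rewrite -xy in E yq uyq *; congr (_ :: _); apply: (IH x) => //=; rewrite ?uxp ?uyq.
Qed.

(** Simple paths in a tree have no chords. *)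
Lemma adj_head n p x : path e n p -> uniq (n :: p) -> x \in p -> e n x ->
  x = head x p.
Proof.
case: p => [//|y p] /= /andP[ny yp] /andP[nyp _] xp nx.
case/splitPl: xp nyp yp => p1 p2 lst; rewrite cat_path -cat_cons mem_cat negb_or.
move=> /andP[nyp1 _] /andP[yp1 _]; apply/esym.
exact: (nbr_disconnected ny nx yp1 lst).
Qed.

Lemma mem_behead n p : path e n p -> uniq (n :: p) ->
  forall x, (x \in behead p) = (x \in p) && ~~ e n x.
Proof.
case: p => [//|y p] np unp x; rewrite [behead _]/= inE.
case: (eqVneq x y) => [->|xy] /=.
  move: np unp => /= /andP[-> _] /and3P[_ yp _]; exact: negPf.
case xp : (x \in p) => //=; apply/esym/negP => nx.
have := adj_head np unp _ nx; rewrite inE xp orbT => /(_ isT) /= E.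
by rewrite E eqxx in xy.
Qed.

Lemma mem_tpath n p z : path e n p -> uniq (n :: p) -> last n p = z ->
  tpath n z =i n :: p.
Proof.
move=> np unp lst x; rewrite [LHS]inE; apply/asboolP/idP => [[q [nq uq lq]]|xp].
  by rewrite (simple_path_unique np unp nq uq) ?lst.
by exists p; split.
Qed.

(** The interior [p] is kept apart from both extremities because the set of its
    vertices is the one whose determinant is taken; the extremities may have any
    valency. *)
Definition chain n p z :=
  [&& path e n (rcons p z), uniq (n :: rcons p z) & all (fun v => valency v == 2%N) p].

Lemma chain_path n p z : chain n p z -> path e n (rcons p z).
Proof. by case/and3P. Qed.

Lemma chain_uniq n p z : chain n p z -> uniq (n :: rcons p z).
Proof. by case/and3P. Qed.

Lemma chain_valency n p z v : chain n p z -> v \in p -> valency v = 2%N.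
Proof. by case/and3P => _ _ /allP h /h /eqP. Qed.

Lemma chain_neq n p z : chain n p z -> n != z.
Proof.
move/chain_uniq; rewrite /= mem_rcons inE negb_or.
by case/andP => /andP[].
Qed.

Lemma chain_rev n p z : chain n p z -> chain z (rev p) n.
Proof.
case/and3P => np unp vp; apply/and3P; split.
- rewrite -rev_cons -[z](last_rcons n p z) -(belast_rcons n p z) rev_path.
  by rewrite (@eq_path _ _ e) // => a b; exact: adj_sym.
- rewrite -rev_cons; have -> : z :: rev (n :: p) = rev (n :: rcons p z).
    by rewrite -rcons_cons rev_rcons.
  by rewrite rev_uniq.
- by rewrite all_rev.
Qed.

Lemma chain_tpath n p z : chain n p z -> tpath n z =i n :: rcons p z.
Proof. by case/and3P => np unp _; apply: mem_tpath => //; rewrite last_rcons. Qed.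

Lemma chain_oo n p z : chain n p z -> path_oo n z =i p.
Proof.
move=> c x; rewrite /path_oo finset.in_setD finset.in_set2 (chain_tpath c).
have := chain_uniq c; rewrite /= rcons_uniq mem_rcons inE.
rewrite negb_or => /and3P[/andP[nz np] zp _].
rewrite inE mem_rcons inE; case: (eqVneq x n) => [->|xn] /=.
  by rewrite (negPf np).
by case: (eqVneq x z) => [->|xz] //=; rewrite (negPf zp).
Qed.

Lemma chain_oc n p z : chain n p z -> path_oc n z =i rcons p z.
Proof.
move=> c x; rewrite /path_oc finset.in_setD1 (chain_tpath c) inE.
have /andP[nz _] := chain_uniq c.
by case: (eqVneq x n) => [->|xn] //=; rewrite (negPf nz).
Qed.

Lemma chain_head n p z : chain n p z -> e n (head z p).
Proof. by move/chain_path; case: p => [|x p] /= /andP[]. Qed.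

Lemma chain_toward n p z : chain n p z -> toward n z = head z p.
Proof.
move=> c; rewrite /toward; case: pickP => [x|none] /=.
  rewrite (chain_tpath c) inE => /andP[/orP[/eqP ->|xp] nx].
    by rewrite adj_irr in nx.
  rewrite (adj_head (chain_path c) (chain_uniq c) xp nx).
  by case: (p).
have := none (head z p); rewrite (chain_tpath c) (chain_head c) andbT.
by case: (p) => [|x q] /=; rewrite !inE eqxx !orbT.
Qed.

Lemma chain_toward_rev n p z : chain n p z -> toward z n = last n p.
Proof.
move/chain_rev/chain_toward ->; case/lastP: p => [|p x] //.
by rewrite rev_rcons last_rcons.
Qed.

Lemma valency2_nbr v x y w : valency v = 2%N -> e v x -> e v y -> x != y ->
  e v w = (w == x) || (w == y).
Proof.
move=> v2 vx vy xy; have : [set x; y] == [set w | e v w].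
  rewrite eqEcard cards2 xy; move: v2; rewrite /valency => ->; rewrite leqnn andbT.
  by apply/fintype.subsetP => a; rewrite !inE => /orP[] /eqP ->.
by move=> /eqP /setP /(_ w); rewrite !inE => <-.
Qed.

Lemma chain_cons n x p z : chain n (x :: p) z ->
  [/\ e x n, chain x p z, valency x = 2%N & n != head z p].
Proof.
move=> c; have xn : e x n by rewrite adj_sym; apply: (chain_head c).
case/and3P: c => /= /andP[nx xp] /and3P[nxp xp' up] /andP[/eqP vx vp]; split=> //.
  by apply/and3P; split=> //=; rewrite xp'.
apply: contraNneq nxp => ->; rewrite inE mem_rcons.
by case: (p) => [|y q] /=; rewrite !inE eqxx !orbT.
Qed.

(** At a vertex of valency 2 there is only one way to go on, and a chain stops at
    the first vertex of another valency. *)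
Lemma chain_unique n p z q z' : chain n p z -> chain n q z' ->
  valency z != 2%N -> valency z' != 2%N -> head z p = head z' q -> p = q /\ z = z'.
Proof.
elim: p n q => [|x p IH] n [|y q] //=.
- by move=> _ /chain_cons [_ _ vy _] vz _ E; rewrite E vy in vz.
- by move=> /chain_cons [_ _ vx _] _ _ vz E; rewrite -E vx in vz.
move=> /chain_cons [xn xp vx nhx] /chain_cons [yn yq vy nhy] vz vz' E.
rewrite -E in yn yq vy *.
have := valency2_nbr (head z' q) vx xn (chain_head xp) nhx.
rewrite (chain_head yq) eq_sym (negPf nhy) /= => /esym/eqP E'.
by have [-> ->] := IH _ _ xp yq vz vz' (esym E').
Qed.

(** The second neighbour of the last vertex is new, since meeting the chain again
    would close a cycle. *)
Lemma chain_extend n p z : chain n p z -> valency z = 2%N ->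
  exists y, chain n (rcons p z) y.
Proof.
move=> c vz; set y := last n p.
have zy : e z y.
  by have := chain_path c; rewrite rcons_path adj_sym => /andP[].
have [x zx xy] : exists2 x, e z x & x != y.
  have : (0 < #|[set w | e z w] :\ y|)%N.
    by move: vz; rewrite /valency (cardsD1 y) inE zy add1n => -[->].
  by case/card_gt0P => x; rewrite !inE => /andP[? ?]; exists x.
exists x; case/and3P: (c) => np unp vp; apply/and3P; split; last 1 first.
- by rewrite all_rcons vp vz eqxx.
- by rewrite rcons_path np last_rcons.
rewrite -rcons_cons rcons_uniq unp andbT -rcons_cons mem_rcons inE negb_or.
apply/andP; split; first by apply: contraTneq zx => ->; rewrite adj_irr.
apply: contraNN xy => xp; apply/eqP.
move: np unp; rewrite rcons_path -rcons_cons rcons_uniq => /andP[np _] /andP[znp _].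
case/splitPl: xp np @y zy znp => p1 p2 lst; rewrite cat_path lst.
move=> /andP[_ xp2]; rewrite last_cat lst => y zy znp.
apply: (nbr_disconnected zx zy xp2) => //.
apply: contraNN znp; rewrite inE => /orP[/eqP ->|zp2].
  by rewrite -lst -cat_cons mem_cat mem_last.
by rewrite -cat_cons mem_cat zp2 orbT.
Qed.

(** Walk on through vertices of valency 2 as long as possible; the walk is simple,
    so the number of vertices bounds its length. *)
Lemma chain_exists n w : e n w ->
  exists p z, [/\ chain n p z, head z p = w & valency z != 2%N].
Proof.
move=> nw.
suff H k p z : chain n p z -> head z p = w -> (#|G| <= size p + k)%N ->
    exists p z, [/\ chain n p z, head z p = w & valency z != 2%N].
  apply: (H #|G| [::] w) => //.
  rewrite /chain /= nw inE !andbT.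
  by apply: contraTneq nw => ->; rewrite adj_irr.
elim: k p z => [|k IH] p z c hw le.
  have le2 : (size (n :: rcons p z) <= #|G|)%N.
    by rewrite -(card_uniqP (chain_uniq c)) max_card.
  by have := leq_trans le2 le; rewrite /= size_rcons addn0 ltnNge leqnSn.
have [vz|vz] := eqVneq (valency z) 2%N; last by exists p, z.
have [y cy] := chain_extend c vz; apply: (IH _ _ cy); last by rewrite size_rcons; lia.
by move: hw; case: (p).
Qed.

(** With [valency2_nbr], the first steps of the two pieces are all the neighbours
    of [v]. *)
Lemma chain_interior n p z v : chain n p z -> v \in p ->
  exists p1 p2, [/\ p = p1 ++ v :: p2, chain v p2 z, chain v (rev p1) n &
    last n p1 != head z p2].
Proof.
move=> c vp; case/splitPr: vp c => p1 p2 c; exists p1, p2; split=> //.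
- elim: p1 n c => [|x p1 IH] n /= /chain_cons [] //.
  by move=> _ /IH.
- have : chain z (rev p2 ++ v :: rev p1) n.
    by have := chain_rev c; rewrite rev_cat rev_cons cat_rcons.
  elim: (rev p2) z {c} => [|x q IH] z /= /chain_cons [] //.
  by move=> _ /IH.
- elim: p1 n c => [|x p1 IH] n /= /chain_cons [] //.
  by move=> _ /IH.
Qed.

End Trees.

(** * Chains from a node to its neighbouring nodes and ends *)

Section NodesAndLegs.
Variable G : plumbing_graph.
Hypothesis acy : acyclic G.
Hypothesis conn : connected_graph G.
Implicit Types (v w x z : G) (p q : seq G) (n m : node G) (u : leaf G).
Local Notation e := (@adj G).

Lemma node_valency n : (2 < valency n)%N. Proof. by case: n. Qed.
Lemma leaf_valency u : valency u = 1%N. Proof. by case: u => u /= /eqP. Qed.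
Lemma node_valency_neq2 n : valency n != 2%N.
Proof. by have := node_valency n; case: (valency n) => [|[|[]]]. Qed.
Lemma leaf_valency_neq2 u : valency u != 2%N. Proof. by rewrite leaf_valency. Qed.
Lemma node_leaf n u : (n : G) != (u : G).
Proof. by apply: contraTneq (node_valency n) => ->; rewrite leaf_valency. Qed.

Lemma chain_not_node (w : G) p z m : chain w p z -> (m : G) \notin p.
Proof.
by move=> c; apply/negP => /(chain_valency c) E; have := node_valency m; rewrite E.
Qed.

(** The predecessor and the successor on the path are two distinct neighbours. *)
Lemma simple_path_valency w p z v : path e w (rcons p z) -> uniq (w :: rcons p z) ->
  v \in p -> (2 <= valency v)%N.
Proof.
move=> wp uwp vp; case/splitPr: vp wp uwp => p1 p2.
rewrite rcons_cat rcons_cons cat_path -cat_cons cat_uniq => /andP[_].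
move=> /= /andP[vl vp2] /and4P[_ /norP[_ nvp2] _ _].
pose y := head z p2.
have ev : e v y by rewrite /y; case: (p2) vp2 => [|a b] /= /andP[].
have yp2 : y \in rcons p2 z.
  by rewrite /y mem_rcons; case: (p2) => [|a b] /=; rewrite !inE eqxx ?orbT.
have ne : last w p1 != y.
  apply: contraNneq nvp2 => E; apply/hasP; exists y => //.
  by rewrite -E mem_last.
have <- : #|[set last w p1; y]| = 2%N by rewrite cards2 ne.
apply: subset_leq_card; apply/fintype.subsetP => a; rewrite !inE.
by case/orP => /eqP -> //; rewrite adj_sym.
Qed.

(** An interior vertex of the simple path has valency at least 2, hence exactly 2
    when it is not a node. *)
Lemma simple_chain n z : (n : G) != z ->
  (forall m, (m : G) \in path_oo n z -> False) -> exists p, chain n p z.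
Proof.
move=> nz noo; have /connectP [q nq] := conn n z.
case/shortenP: nq => p np unp _ zE.
case/lastP: p np unp zE => [|p y] np unp; rewrite ?last_rcons => E.
  by rewrite E eqxx in nz.
move: np unp; rewrite -{}E => np unp; exists p.
apply/and3P; split=> //; apply/allP => v vp.
have := simple_path_valency np unp vp; rewrite leq_eqVlt => /orP[/eqP <-//|v3].
case: (noo (Node v3)); rewrite /path_oo finset.in_setD finset.in_set2.
rewrite (mem_tpath acy np unp) ?last_rcons // inE mem_rcons inE vp !orbT andbT.
move: unp; rewrite /= mem_rcons rcons_uniq inE !negb_or.
move=> /andP[/andP[_ nnp]] /andP[zp _].
by apply/andP; split; [apply: contraNneq nnp | apply: contraNneq zp] => <-.
Qed.

Lemma nbrP n m : reflect (exists p, chain n p m) (nbr n m).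
Proof.
apply: (iffP andP) => [[mn /forallP noo]|[p c]].
  apply: simple_chain; first by apply: contraNneq mn => E; apply/eqP/val_inj.
  by move=> m'; apply/negP.
split; first by apply: contraNneq (chain_neq c) => ->.
by apply/forallP => m'; rewrite (chain_oo acy c) (chain_not_node _ c).
Qed.

Lemma leaf_ofP n u : reflect (exists p, chain n p u) (leaf_of n u).
Proof.
apply: (iffP forallP) => [noo|[p c] m].
  apply: simple_chain; first exact: node_leaf.
  move=> m; have := noo m; rewrite /path_oo /path_oc !finset.in_setD finset.in_set1.
  rewrite finset.in_set2 negb_or => /negP h /andP[/andP[h1 h2] h3].
  by apply: h; rewrite h1.
by rewrite (chain_oc acy c) mem_rcons inE negb_or node_leaf (chain_not_node _ c).
Qed.

Lemma nbr_sym n m : nbr n m = nbr m n.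
Proof. by apply/nbrP/nbrP => -[p /chain_rev c]; eexists; exact: c. Qed.

Lemma toward_inj n p z q z' : chain n p z -> chain n q z' ->
  valency z != 2%N -> valency z' != 2%N -> toward n z = toward n z' -> z = z'.
Proof.
move=> c c' vz vz'; rewrite (chain_toward acy c) (chain_toward acy c').
by move=> /(chain_unique c c' vz vz') [].
Qed.

(** Every edge at a node starts exactly one chain, which ends at a neighbouring
    node or at an end of the leg. *)
Lemma sum_adj_node (V : nmodType) n (f : G -> V) :
  \sum_(w | e n w) f w = \sum_(n' | nbr n n') f (toward n n')
    + \sum_(u | leaf_of n u) f (toward n u).
Proof.
have tn n' : nbr n n' -> e n (toward n n').
  by case/nbrP => p c; rewrite (chain_toward acy c) (chain_head c).
have tl u : leaf_of n u -> e n (toward n u).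
  by case/leaf_ofP => p c; rewrite (chain_toward acy c) (chain_head c).
rewrite (partition_big (fun n' : node G => toward n n') (e n)) //=.
rewrite (partition_big (fun u : leaf G => toward n u) (e n) (P := leaf_of n)) //=.
rewrite -big_split /=; apply: eq_bigr => w nw.
have [p [z [c hw vz]]] := chain_exists acy nw.
have tw : toward n z = w by rewrite (chain_toward acy c).
have z1 : (0 < valency z)%N.
  apply/card_gt0P; exists (last (n : G) p); rewrite inE adj_sym.
  by move: (chain_path c); rewrite rcons_path => /andP[].
have [z3|z3] := ltnP 2 (valency z).
  rewrite (big_pred1 (Node z3)) ?tw => [|n' /=]; last first.
    apply/andP/eqP => [[/nbrP [q cq]] /eqP E|->] /=.
      by apply/val_inj; apply: (toward_inj cq c) => //; rewrite ?node_valency_neq2 // E.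
    by split; [apply/nbrP; exists p | apply/eqP].
  rewrite big1 ?addr0 // => u /andP[/leaf_ofP [q cq] /eqP E].
  have uz : (u : G) = z by apply: (toward_inj cq c) => //; rewrite ?leaf_valency_neq2 // E.
  by have := leaf_valency u; rewrite uz => E1; rewrite E1 in z3.
have {}z1 : valency z == 1%N by move: z1 z3 vz; case: (valency z) => [|[|[]]].
rewrite [X in _ = _ + X](big_pred1 (Leaf z1)) ?tw => [|u /=]; last first.
  apply/andP/eqP => [[/leaf_ofP [q cq]] /eqP E|->] /=.
    by apply/val_inj; apply: (toward_inj cq c) => //; rewrite ?leaf_valency_neq2 // E.
  by split; [apply/leaf_ofP; exists p | apply/eqP].
rewrite big1 ?add0r // => n' /andP[/nbrP [q cq] /eqP E].
have nz : (n' : G) = z by apply: (toward_inj cq c) => //; rewrite ?node_valency_neq2 // E.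
by have := node_valency n'; rewrite nz (eqP z1).
Qed.

(** Where the vertices carrying the edge coefficients of a lift can lie: inside a
    chain such a vertex has as neighbour a node, which must be an extremity, and then
    the chain is the one that this coefficient belongs to. *)
Lemma edge_vertex m m' (w z v : G) p : nbr m m' -> toward m m' = v ->
    chain w p z -> v \in p -> valency w != 2%N -> valency z != 2%N ->
  [/\ (m : G) = w, (m' : G) = z & v = head z p] \/
  [/\ (m : G) = z, (m' : G) = w & v = last w p].
Proof.
move=> /nbrP [q cq]; rewrite (chain_toward acy cq) => hq c vp vw vz.
have v2 := chain_valency c vp.
have [p1 [p2 [pE c2 c1 ne]]] := chain_interior c vp.
have [q' qE] : exists q', q = v :: q'.
  case: q hq {cq} => [/= E|a q /= ->]; last by exists q.
  by have := node_valency_neq2 m'; rewrite E v2.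
have vm : e v m by rewrite adj_sym -hq (chain_head cq).
have h1 := chain_head c1; have h2 := chain_head c2.
have hl : head w (rev p1) = last w p1.
  by case/lastP: (p1) => // a b; rewrite rev_rcons last_rcons.
rewrite hl in h1.
move: vm; rewrite (valency2_nbr m v2 h1 h2 ne) => /orP[] /eqP mE.
  left; have p10 : p1 = [::].
    case/lastP: p1 pE {c1 h1 ne hl} mE => // a b pE; rewrite last_rcons => mE.
    by have := chain_not_node m c; rewrite pE mem_cat mem_rcons mE inE eqxx.
  rewrite p10 /= in pE mE; rewrite mE in cq.
  have hE : head (m' : G) q = head z p by rewrite hq pE.
  have [_ ->] := chain_unique cq c (node_valency_neq2 m') vz hE.
  by rewrite mE pE.
right; have p20 : p2 = [::].
  case: p2 pE {c2 h2 ne} mE => // a b pE /= mE.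
  by have := chain_not_node m c; rewrite pE mem_cat mE !inE eqxx !orbT.
rewrite p20 /= in mE; rewrite mE in cq.
have := chain_rev c; rewrite pE p20 rev_cat /= => c'.
have [_ ->] := chain_unique cq c' (node_valency_neq2 m') vw hq.
by rewrite mE last_cat.
Qed.

End NodesAndLegs.

(** * Continuants and Seifert invariants *)

Section ChainSolve.
Variables (G : plumbing_graph) (R : realType).
Hypothesis acy : acyclic G.
Variables (y d : G -> R).
Implicit Types (v w x z : G) (p q s : seq G).
Local Notation e := (@adj G).

Definition balanced v : Prop :=
  - (deco v)%:~R * y v = \sum_(w | e v w) y w + d v.

Fixpoint three_term (y0 : R) s (y1 : R) : Prop :=
  if s is x :: q then
    - (deco x)%:~R * y x = y0 + (if q is x' :: _ then y x' else y1) + d x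
    /\ three_term (y x) q y1
  else True.

(** The inhomogeneous part of the solution of the recursion at the first vertex: the
    first row of the adjugate of the tridiagonal matrix, applied to [d]. *)
Fixpoint green s : R :=
  if s is x :: q then (detseq q)%:~R * d x + green q else 0.

(** Cramer rule for the first unknown of a tridiagonal system, by
    induction on its length with the continuant recursion. *)
Lemma three_term_solve x q y0 y1 : path e x q -> uniq (x :: q) ->
    three_term y0 (x :: q) y1 ->
  (detseq (x :: q))%:~R * y x = (detseq q)%:~R * y0 + green (x :: q) + y1.
Proof.
elim: q x y0 => [|x' q IH] x y0 xq uxq.
  by move=> [E _]; rewrite detseq1 detseq0 /= detseq0 rmorphN /= E; ring.
move=> [E]; have [xx' x'q] := andP xq; have [xnq uq] := andP uxq.
move=> /(IH x' (y x) x'q uq) E'.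
have far : {in q, forall z, ~~ e x z}.
  by move=> z zq; have := mem_behead acy xq uxq z; rewrite /= zq => /esym/andP[].
have uxx : uniq [:: x, x' & q] by [].
rewrite [green _]/= (detseq_rec xx' uxx far) rmorphB rmorphM rmorphN /=.
have -> : (detseq q)%:~R * d x' + green q =
    (detseq (x' :: q))%:~R * y x' - (detseq q)%:~R * y x - y1.
  by rewrite E' /=; ring.
rewrite mulrBl mulrAC E; ring.
Qed.

Lemma chain_three_term n p z : chain n p z -> {in p, forall v, balanced v} ->
  three_term (y n) p (y z).
Proof.
elim: p n => [//|x p IH] n /chain_cons[xn c vx ne] bal; split; last first.
  by apply: IH => // v vp; apply: bal; rewrite inE vp orbT.
rewrite (bal x) ?mem_head // (eq_bigl (pred2 n (head z p))); last first.
  by move=> w; rewrite /= (valency2_nbr w vx xn (chain_head c) ne).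
rewrite (bigD1 n) /= ?eqxx // (big_pred1 (head z p)).
  by case: (p).
move=> w /=; case: (eqVneq w n) => [->|] /=; last by rewrite andbT.
by rewrite (negPf ne).
Qed.

(** An end has a single neighbour, so its equation has boundary value 0. *)
Lemma leg_three_term n p z : chain n p z -> valency z = 1%N ->
  {in rcons p z, forall v, balanced v} -> three_term (y n) (rcons p z) 0.
Proof.
move=> c vz; elim: p n c => [|x p IH] n c bal.
  have zn : e z n by rewrite adj_sym; apply: (chain_head c).
  split=> //; rewrite (bal z) ?inE // addr0 (big_pred1 n) // => w /=.
  have /cards1P [a aE] : #|[set w | e z w]| == 1%N by rewrite -vz.
  move/setP: aE => aE; have := aE n; have := aE w; rewrite !inE zn => ->.
  by move=> /esym/eqP ->.
have [xn c' vx ne] := chain_cons c.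
split; last by apply: IH => // v vp; apply: bal; rewrite inE vp orbT.
rewrite (bal x) ?mem_head // (eq_bigl (pred2 n (head z p))); last first.
  by move=> w; rewrite /= (valency2_nbr w vx xn (chain_head c') ne).
rewrite (bigD1 n) /= ?eqxx // (big_pred1 (head z p)).
  by case: (p).
move=> w /=; case: (eqVneq w n) => [->|] /=; last by rewrite andbT.
by rewrite (negPf ne).
Qed.

Lemma green_last x q (B : R) : uniq (x :: q) ->
    {in x :: q, forall v, d v = (v == last x q)%:R * B} -> green (x :: q) = B.
Proof.
elim: q x => [|x' q IH] x uq dB.
  by rewrite /= detseq0 dB ?mem_head //= eqxx mulr1z !mul1r addr0.
have [xq uq'] := andP uq.
rewrite [LHS]/= -/(green (x' :: q)) (IH x') //.
  rewrite dB ?mem_head //= (_ : x == _ = false) ?mul0r ?mulr0 ?add0r //.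
  by apply: contraNF xq => /eqP ->; exact: (mem_last x' q).
by move=> v vq; rewrite dB ?inE ?vq ?orbT //; rewrite inE in vq; rewrite vq orbT.
Qed.

(** The entries of the first row of the adjugate at the two ends of the list are the
    continuant of the tail and 1. *)
Lemma green_ends x q (A B : R) : uniq (x :: q) ->
    {in x :: q, forall v, d v = (v == x)%:R * A + (v == last x q)%:R * B} ->
  green (x :: q) = (detseq q)%:~R * A + B.
Proof.
case: q => [|x' q] uq dB.
  by rewrite /= detseq0 dB ?mem_head //= eqxx mulr1z !mul1r addr0.
have [xq uq'] := andP uq.
rewrite [LHS]/= -/(green (x' :: q)) (@green_last x' q B) //.
  rewrite dB ?mem_head // eqxx (_ : x == _ = false) ?mul0r ?addr0 ?mul1r //.
  by apply: contraNF xq => /eqP ->; exact: (mem_last x' q).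
move=> v vq; rewrite dB ?inE ?vq ?orbT //; last by move: vq; rewrite inE => ->; rewrite orbT.
rewrite (_ : v == x = false) ?mul0r ?add0r //.
by apply: contraNF xq => /eqP <-.
Qed.

End ChainSolve.

Section SeifertData.
Variables (G : plumbing_graph).
Hypothesis acy : acyclic G.
Implicit Types (n m : node G) (u : leaf G) (p : seq G).

Lemma detg_chain_oo (n z : G) p : chain n p z -> detg (path_oo n z) = detseq p.
Proof.
move=> c; apply: detg_seq; last exact: chain_oo.
by have := chain_uniq c; rewrite /= rcons_uniq => /and3P[].
Qed.

Lemma detg_del_chain (n : G) p (A : {set G}) : path (@adj G) n p -> uniq (n :: p) ->
  A =i p -> detg (del_adjacent n A) = detseq (behead p).
Proof.
move=> np unp Ap; apply: detg_seq.
  by case: (p) unp => //= a b /and3P[].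
by move=> x; rewrite inE (mem_behead acy np unp) Ap.
Qed.

Lemma alpha_chain n m p : chain n p m -> alpha n m = detseq p.
Proof. exact: detg_chain_oo. Qed.

Lemma omega_chain n m p : chain n p m ->
  omega n m = if p is _ :: q then detseq q else 0.
Proof.
move=> c; have oo := chain_oo acy c; rewrite /omega.
case: p c oo => [|x q] c oo.
  have -> : path_oo n m = finset.set0 by apply/setP => x; rewrite oo finset.in_set0.
  by rewrite eqxx.
case: eqP => [E|_].
  by have := oo x; rewrite E finset.in_set0 mem_head.
rewrite (@detg_del_chain n (x :: q)) //.
  by have := chain_path c; rewrite rcons_path => /andP[].
by have := chain_uniq c; rewrite -rcons_cons rcons_uniq => /andP[].
Qed.

Lemma alpha_leaf_chain n u p : chain n p u -> alpha_leaf n u = detseq (rcons p u).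
Proof.
move=> c; apply: detg_seq; last exact: chain_oc.
by have /andP[] := chain_uniq c.
Qed.

Lemma omega_leaf_chain n u p : chain n p u ->
  omega_leaf n u = detseq (behead (rcons p u)).
Proof.
move=> c; apply: detg_del_chain (chain_path c) (chain_uniq c) _.
exact: chain_oc.
Qed.

End SeifertData.

(** * The coordinates of a lift along the chains *)

Section LiftVector.
Variables (R : realType) (G : plumbing_graph).
Hypothesis acy : acyclic G.
Hypothesis conn : connected_graph G.
Hypothesis neg : negative_definite G.
Variables (ord : rel (node G)) (a : reduced_lift G).
Implicit Types (n m : node G) (u : leaf G) (v w : G) (p : seq G).

Definition edge_coef v : R :=
  \sum_(p : node G * node G | nlt ord p.1 p.2 && (toward p.1 p.2 == v))
    (rl_edge a p.1 p.2)%:~R.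

Definition lift_coef v : R :=
  \sum_(n : node G | (n : G) == v) (rl_node a n)%:~R
  + \sum_(u : leaf G | (u : G) == v) (rl_leaf a u)%:~R + edge_coef v.

(** Extended by 0 so that the formulas are symmetric in the two orders of a pair. *)
Definition edge_val n m : R := if nlt ord n m then (rl_edge a n m)%:~R else 0.

Lemma pairing_Evec (x : {ffun G -> R}) v :
  pairing x (Evec R v) = x v * (deco v)%:~R + \sum_(w | adj v w) x w.
Proof.
rewrite /pairing; transitivity (\sum_w x w * (eform w v)%:~R).
  apply: eq_bigr => w _; rewrite (bigD1 v) //= big1 ?addr0 => [|v' v'v].
    by rewrite !ffunE eqxx mulr1.
  by rewrite [Evec _ _ _]ffunE (negPf v'v) mulr0.
rewrite (bigD1 v) //= /eform eqxx; congr (_ + _).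
rewrite [RHS]big_mkcond [RHS](bigD1 v) //= adj_irr add0r.
apply: eq_bigr => w wv; rewrite (negPf wv) adj_sym.
by case: (adj v w); rewrite ?mulr1 // mulr0.
Qed.

(** The E*_v are dual to the E_v up to sign. *)
Lemma pairing_lift_vec v : pairing (lift_vec R ord a) (Evec R v) = - lift_coef v.
Proof.
have sub z : zmod_morphism (fun x : {ffun G -> R} => pairing x z).
  move=> x y; rewrite /pairing -sumrB; apply: eq_bigr => i _.
  by rewrite -sumrB; apply: eq_bigr => j _; rewrite !ffunE; ring.
pose phi : {additive {ffun G -> R} -> R} :=
  HB.pack (fun x : {ffun G -> R} => pairing x (Evec R v))
          (GRing.isZmodMorphism.Build _ _ _ (sub (Evec R v))).
have mem (I : finType) (P : pred I) (f : I -> G) (k : I -> int) :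
    phi (\sum_(i | P i) Estar R (f i) *~ k i) = - \sum_(i | P i && (f i == v)) (k i)%:~R.
  rewrite raddf_sum -sumrN big_mkcondr; apply: eq_bigr => i _.
  have -> : phi (Estar R (f i) *~ k i) = phi (Estar R (f i)) *~ k i by exact: raddfMz.
  rewrite [phi _](pairing_Estar (f i) v (form_mx_unit R neg)).
  by case: (f i == v); rewrite ?oppr0 ?mul0rz // mulNrz.
rewrite -[LHS]/(phi _) /lift_vec (raddfD phi) (raddfD phi) !mem -!opprD.
by [].
Qed.

Lemma lift_balanced v : balanced (lift_vec R ord a) lift_coef v.
Proof.
have := pairing_lift_vec v; rewrite pairing_Evec /balanced => E.
have -> : lift_coef v = - (- lift_coef v) by rewrite opprK.
by rewrite -E; ring.
Qed.

(** By [edge_vertex], only the two orders of the pair contribute; the vertices next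
    to [n] and next to [m] may coincide. *)
Lemma edge_coef_chain n m p v : chain n p m -> v \in p ->
  edge_coef v = (v == head (m : G) p)%:R * edge_val n m
              + (v == last (n : G) p)%:R * edge_val m n.
Proof.
move=> c vp; have nm : n != m by apply: contraNneq (chain_neq c) => ->.
rewrite /edge_coef big_mkcond (bigD1 (n, m)) //= (bigD1 (m, n)) /=; last first.
  by rewrite xpair_eqE negb_and (eq_sym m) nm.
rewrite big1 ?addr0 => [|[m1 m2] /andP[/= h1 h2]].
  rewrite (chain_toward acy c) (chain_toward_rev acy c) /edge_val.
  rewrite (eq_sym (head _ _)) (eq_sym (last _ _)).
  by congr (_ + _); case: nlt => /=; case: (v == _); rewrite ?mul1r ?mul0r.
case: ifP => // /andP[/andP[/= nb _] /eqP tv].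
have [[] E1 E2 _|[] E1 E2 _] :=
  edge_vertex acy conn nb tv c vp (node_valency_neq2 n) (node_valency_neq2 m).
  by case/eqP: h1; congr (_, _); exact: val_inj.
by case/eqP: h2; congr (_, _); exact: val_inj.
Qed.

Lemma edge_coef_leg n u p v : chain n p u -> v \in rcons p (u : G) -> edge_coef v = 0.
Proof.
move=> c vp; rewrite /edge_coef big_pred0 // => -[m1 m2] /=.
apply/negP => /andP[/andP[nb _] /eqP tv].
move: vp; rewrite mem_rcons inE => /orP[/eqP vu|vp].
  have /nbrP := nb => /(_ acy conn) [q cq].
  move: tv; rewrite (chain_toward acy cq) vu; case: q cq => [|w q] cq /= E.
    by have := node_leaf m2 u; rewrite E eqxx.
  by have := chain_valency cq (mem_head _ _); rewrite E leaf_valency.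
have [[] E1 E2 _|[] E1 E2 _] :=
  edge_vertex acy conn nb tv c vp (node_valency_neq2 n) (leaf_valency_neq2 u).
  by have := node_leaf m2 u; rewrite E2 eqxx.
by have := node_leaf m1 u; rewrite E1 eqxx.
Qed.

(** When two neighbouring nodes are adjacent, the coefficient of their edge is
    supported at a node, and enters the balance there. *)
Definition merged_edge_val n m : R :=
  if nlt ord m n && (path_oo m n == finset.set0) then (rl_edge a m n)%:~R else 0.

Lemma edge_coef_node n : edge_coef n = \sum_(m | nbr n m) merged_edge_val n m.
Proof.
rewrite /edge_coef.
rewrite -(pair_big_dep xpredT (fun m m' => nlt ord m m' && (toward m m' == n :> G))
  (fun m m' => (rl_edge a m m')%:~R)) /=.
rewrite [RHS]big_mkcond; apply: eq_bigr => m _.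
have key m' : nlt ord m m' && (toward m m' == n :> G) =
    [&& m' == n, nlt ord m n & path_oo m n == finset.set0].
  apply/idP/idP => [/andP[lt /eqP tv]|/and3P[/eqP -> lt /eqP oo]].
    have /andP[/nbrP nb _] := lt; have [q cq] := nb acy conn.
    move: tv; rewrite (chain_toward acy cq); case: q cq => [|w q] cq /= E; last first.
      by have := node_valency_neq2 n; rewrite -E (chain_valency cq (mem_head _ _)).
    have mn : m' = n by apply: val_inj.
    rewrite -mn eqxx lt; apply/eqP/setP => w.
    by rewrite (chain_oo acy cq) finset.in_set0.
  rewrite lt; have /andP[/nbrP nb _] := lt; have [q cq] := nb acy conn.
  rewrite (chain_toward acy cq); case: q cq => [|w q] cq //=.
  by have := chain_oo acy cq w; rewrite oo finset.in_set0 mem_head.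
rewrite (eq_bigl _ _ key) /merged_edge_val.
case h: (nlt ord m n && _).
  have /andP[/andP[nb _] _] := h.
  rewrite (nbr_sym acy conn) nb (big_pred1 n) // => m' /=.
  by rewrite andbT.
by rewrite big_pred0 => [|m']; [case: ifP | rewrite andbF].
Qed.

(** The solution of the recursion along the chain from [n] to [m].  The edge
    coefficient sits at the vertex next to the smaller node, so it adds to the
    boundary value at that node; with an empty chain it sits at the other node, which
    [merged_edge_val] accounts for. *)
Lemma nbr_value n m : nbr n m ->
  lift_vec R ord a (toward n m) + merged_edge_val n m =
    (omega n m)%:~R / (alpha n m)%:~R * (lift_vec R ord a (n : G) + edge_val n m)
    + (lift_vec R ord a (m : G) + edge_val m n) / (alpha n m)%:~R.
Proof.
move=> nb; have [p c] := nbrP acy conn _ _ nb.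
have a0 : (alpha n m)%:~R != 0 :> R by rewrite intr_eq0 detg_neq0.
have := chain_three_term c (fun v _ => lift_balanced v).
have oo : (path_oo m n == finset.set0) = (p == [::]).
  apply/eqP/eqP => [/setP oo|p0].
    have c' := chain_rev c; case: (p) c' oo => // x q c' /(_ x).
    by rewrite (chain_oo acy c') mem_rev mem_head finset.in_set0.
  apply/setP => x; rewrite (chain_oo acy (chain_rev c)) p0 finset.in_set0.
  by [].
rewrite /merged_edge_val oo (omega_chain acy c) (chain_toward acy c).
have al := alpha_chain acy c.
case: p c al {oo} => [|x q] c al /=.
  by rewrite andbT al detseq0 mul0r mul0r add0r invr1 mulr1.
move=> tt; rewrite andbF addr0.
have := chain_path c; rewrite rcons_path [path _ _ _]/= => /andP[/andP[_ xq] _].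
have := chain_uniq c; rewrite cons_uniq rcons_uniq => /and3P[_ _ uq].
have := three_term_solve acy xq uq tt.
rewrite (green_ends (A := edge_val n m) (B := edge_val m n)) // => [E|v vq].
  apply: (mulfI a0); rewrite {1}al E; field.
  exact: a0.
rewrite /lift_coef (edge_coef_chain c vq) big_pred0 ?add0r => [|n']; last first.
  by apply: contraTF vq => /eqP <-; exact: (chain_not_node _ c).
rewrite big_pred0 ?add0r // => u.
by apply/eqP => E; have := chain_valency c vq; rewrite -E leaf_valency.
Qed.

(** The solution of the recursion along a leg; the end carries the leaf coefficient. *)
Lemma leg_value n u : leaf_of n u ->
  lift_vec R ord a (toward n u) =
   ((omega_leaf n u)%:~R * lift_vec R ord a (n : G) + (rl_leaf a u)%:~R)
     / (alpha_leaf n u)%:~R.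
Proof.
move=> lf; have [p c] := leaf_ofP acy conn _ _ lf.
have a0 : (alpha_leaf n u)%:~R != 0 :> R by rewrite intr_eq0 detg_neq0.
have tt := leg_three_term c (leaf_valency u) (fun v _ => lift_balanced v).
apply: (mulfI a0); rewrite [RHS]mulrC mulfVK //.
rewrite (chain_toward acy c) (omega_leaf_chain acy c) (alpha_leaf_chain acy c).
have [x [q qE]] : exists x q, rcons p (u : G) = x :: q.
  by case: (p) => [|x q]; eexists; eexists.
have hx : head (u : G) p = x by case: (p) qE => [|z s] [].
have lx : last x q = u by rewrite -[RHS](last_rcons x p) qE.
have xq := chain_path c; have := chain_uniq c; rewrite qE in tt xq *.
rewrite hx; case/andP: xq => _ xq /andP[_ uq].
have := three_term_solve acy xq uq tt.
rewrite (green_last (B := (rl_leaf a u)%:~R)) // => [->|v vq]; first by rewrite addr0.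
have vp : v \in rcons p (u : G) by rewrite qE.
rewrite /lift_coef (edge_coef_leg c vp) addr0 lx.
rewrite big_pred0 ?add0r => [|m]; last first.
  move: vp; rewrite mem_rcons inE => /orP[/eqP ->|vp].
    by rewrite (negPf (node_leaf m u)).
  by apply: contraTF vp => /eqP <-; exact: (chain_not_node _ c).
case: eqP => [->|vu]; first by rewrite (big_pred1 u) ?mul1r.
rewrite big_pred0 ?mul0r // => u'.
move: vp; rewrite mem_rcons inE => /orP[/eqP //|vp].
by apply/eqP => E; have := chain_valency c vp; rewrite -E leaf_valency.
Qed.

Lemma node_coef n :
  lift_coef n = (rl_node a n)%:~R + \sum_(m | nbr n m) merged_edge_val n m.
Proof.
rewrite /lift_coef edge_coef_node (big_pred1 n) // big_pred0 ?addr0 // => u.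
by rewrite eq_sym (negPf (node_leaf n u)).
Qed.

End LiftVector.

(** * Linearity of the normalized counting function *)

Section OrbifoldForm.
Variables (R : realType) (G : plumbing_graph).

(** Minus the pairing with E_n for the orbifold intersection form on the node
    coordinates; its diagonal entry, b_n plus the ratios omega/alpha over all chains
    at [n], is the orbifold Euler number at [n]. *)
Definition orb_form (n : node G) (y : {ffun node G -> R}) : R :=
  - ((deco n)%:~R + \sum_(n' | nbr n n') (omega n n')%:~R / (alpha n n')%:~R
     + \sum_(u | leaf_of n u) (omega_leaf n u)%:~R / (alpha_leaf n u)%:~R) * y n
  - \sum_(n' | nbr n n') y n' / (alpha n n')%:~R.

Lemma Nbar_base ord a l (n : node G) :
  Nbar_fun R ord a l n =
    N_base R ord a l n + \sum_(u | leaf_of n u) leaf_quot R a l n u.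
Proof.
rewrite /Nbar_fun /N_fun -addrA -big_split /=; congr (_ + _).
by apply: eq_bigr => u _; rewrite /fract addrC subrK.
Qed.

Lemma orb_formD n x y : orb_form n (x + y) = orb_form n x + orb_form n y.
Proof.
rewrite /orb_form ffunE.
have -> : \sum_(m | nbr n m) (x + y) m / (alpha n m)%:~R =
    \sum_(m | nbr n m) x m / (alpha n m)%:~R + \sum_(m | nbr n m) y m / (alpha n m)%:~R.
  by rewrite -big_split; apply: eq_bigr => m _; rewrite ffunE mulrDl.
ring.
Qed.

Lemma orb_formZ n c (x : {ffun node G -> R}) : 
  orb_form n [ffun m => c * x m] = c * orb_form n x.
Proof.
rewrite /orb_form ffunE.
have -> : \sum_(m | nbr n m) [ffun m => c * x m] m / (alpha n m)%:~R =
    c * \sum_(m | nbr n m) x m / (alpha n m)%:~R.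
  by rewrite mulr_sumr; apply: eq_bigr => m _; rewrite ffunE mulrA.
ring.
Qed.

Lemma Nbar_toR ord a l n :
  Nbar_fun R ord a l n = Nbar_fun R ord a 0 n + orb_form n (toR R l).
Proof.
rewrite !Nbar_base /N_base /orb_form /toR !ffunE.
have -> : \sum_(m | nbr n m)
    (fun_of_fin (0 : {ffun node G -> int}) m)%:~R / (alpha n m)%:~R = 0 :> R.
  by rewrite big1 // => m _; rewrite ffunE mul0r.
have -> : \sum_(m | nbr n m) [ffun k => (l k)%:~R] m / (alpha n m)%:~R =
    \sum_(m | nbr n m) (l m)%:~R / (alpha n m)%:~R :> R.
  by apply: eq_bigr => m _; rewrite ffunE.
have -> : \sum_(u | leaf_of n u) leaf_quot R a l n u =
    \sum_(u | leaf_of n u) leaf_quot R a 0 n u -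
    (\sum_(u | leaf_of n u) (omega_leaf n u)%:~R / (alpha_leaf n u)%:~R) * (l n)%:~R.
  rewrite mulr_suml -sumrB; apply: eq_bigr => u _.
  by rewrite /leaf_quot ffunE mulr0 subr0 rmorphB rmorphM /=; ring.
ring.
Qed.

Hypothesis acy : acyclic G.
Hypothesis conn : connected_graph G.
Hypothesis neg : negative_definite G.

(** Substitute the values of the lift next to [n] in the balance at [n]. *)
Lemma orb_form_c_vec ord a n : orb_form n (c_vec R ord a) = Nbar_fun R ord a 0 n.
Proof.
set x := lift_vec R ord a.
have cx m : c_vec R ord a m = x (m : G) by rewrite ffunE.
have z0 : fun_of_fin (0 : {ffun node G -> int}) n = 0 by rewrite ffunE.
rewrite Nbar_base /N_base /orb_form cx z0.
rewrite (eq_bigr _ (fun m _ => congr1 (fun t => t / _) (cx m))).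
have -> : \sum_(m | nbr n m)
    (fun_of_fin (0 : {ffun node G -> int}) m)%:~R / (alpha n m)%:~R = 0 :> R.
  by rewrite big1 // => m _; rewrite ffunE mul0r.
have E : - (deco n)%:~R * x (n : G) = (rl_node a n)%:~R
    + \sum_(m | nbr n m) (x (toward n m) + merged_edge_val R ord a n m)
    + \sum_(u | leaf_of n u) x (toward n u).
  have := lift_balanced R neg ord a n; rewrite /balanced -/x => ->.
  rewrite (sum_adj_node acy conn) (node_coef R acy conn) big_split /=; ring.
rewrite (eq_bigr _ (fun m nb => nbr_value R acy conn neg ord a nb)) in E.
rewrite (eq_bigr _ (fun u lf => leg_value R acy conn neg ord a lf)) -/x in E.
have F : \sum_(m | nbr n m)
    ((omega n m)%:~R / (alpha n m)%:~R * (x (n : G) + edge_val R ord a n m)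
     + (x (m : G) + edge_val R ord a m n) / (alpha n m)%:~R) =
  (\sum_(m | nbr n m) (omega n m)%:~R / (alpha n m)%:~R) * x (n : G)
  + \sum_(m | nlt ord n m) (omega n m)%:~R / (alpha n m)%:~R * (rl_edge a n m)%:~R
  + \sum_(m | nlt ord m n) (alpha n m)%:~R^-1 * (rl_edge a m n)%:~R
  + \sum_(m | nbr n m) x (m : G) / (alpha n m)%:~R.
  have e1 : \sum_(m | nlt ord n m)
      (omega n m)%:~R / (alpha n m)%:~R * (rl_edge a n m)%:~R
     = \sum_(m | nbr n m) (omega n m)%:~R / (alpha n m)%:~R * edge_val R ord a n m.
    rewrite big_mkcondr; apply: eq_bigr => m nb; rewrite /edge_val /nlt nb /=.
    by case: ifP => // _; rewrite mulr0.
  have e2 : \sum_(m | nlt ord m n) (alpha n m)%:~R^-1 * (rl_edge a m n)%:~R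
     = \sum_(m | nbr n m) (alpha n m)%:~R^-1 * edge_val R ord a m n.
    rewrite /nlt (eq_bigl (fun m => nbr n m && ord m n)); last first.
      by move=> m; rewrite (nbr_sym acy conn).
    rewrite big_mkcondr; apply: eq_bigr => m nb.
    rewrite /edge_val /nlt (nbr_sym acy conn) nb /=.
    by case: ifP => // _; rewrite mulr0.
  rewrite e1 e2 mulr_suml -!big_split /=; apply: eq_bigr => m _; ring.
rewrite F in E.
have F2 : \sum_(u | leaf_of n u)
    ((omega_leaf n u)%:~R * x (n : G) + (rl_leaf a u)%:~R) / (alpha_leaf n u)%:~R
    = (\sum_(u | leaf_of n u) (omega_leaf n u)%:~R / (alpha_leaf n u)%:~R) * x (n : G)
      + \sum_(u | leaf_of n u) leaf_quot R a 0 n u.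
  rewrite mulr_suml -big_split; apply: eq_bigr => u _.
  by rewrite /leaf_quot z0 mulr0 subr0 /=; ring.
rewrite F2 in E.
apply/eqP; rewrite -subr_eq0; apply/eqP; move/eqP: E; rewrite -subr_eq0 => /eqP E.
by rewrite -[RHS]E; ring.
Qed.

Lemma Nbar_orb_form ord a l n :
  Nbar_fun R ord a l n = orb_form n (toR R l + c_vec R ord a).
Proof. by rewrite orb_formD orb_form_c_vec Nbar_toR addrC. Qed.

End OrbifoldForm.

(** * Division with remainder along the shifts *)

Section FundamentalDomain.
Variables (R : realType) (I : finType) (L : zmodType).
Variables (Z : L -> Prop) (N Nb : L -> I -> R) (v : I -> L) (mu : I -> R).
Implicit Types (l : L) (n m : I) (A J : {set I}) (k : I -> nat).

(** Abstracts the normalization: [Z] is the set of solutions of the congruences. *)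
Definition positive l := Z l /\ forall m, 0 <= Nb l m.
(** Abstracts the points of the half-open box. *)
Definition reduced l := Z l /\ forall m, 0 <= Nb l m < mu m.

Hypothesis mu_gt0 : forall n, 0 < mu n.
Hypothesis Z_shift : forall l n, Z (l + v n) <-> Z l.
Hypothesis Nb_shift : forall l n m, Nb (l + v n) m = Nb l m + (m == n)%:R * mu n.
Hypothesis N_shift_other : forall l n m, positive l -> m != n -> N (l + v n) m = N l m.
Hypothesis N_shift_self : forall l n, positive l -> 0 <= N (l + v n) n.

Lemma positive_shift l n : positive l -> positive (l + v n).
Proof.
move=> [Zl Nl]; split=> [|m]; first exact/Z_shift.
by rewrite Nb_shift addr_ge0 // mulr_ge0 // ltW.
Qed.

Lemma shift_many l n j : positive l ->
  [/\ positive (l + v n *+ j), forall m, m != n -> N (l + v n *+ j) m = N l m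
    & (0 < j)%N -> 0 <= N (l + v n *+ j) n].
Proof.
move=> Pl; elim: j => [|j [P1 P2 P3]]; first by rewrite mulr0n addr0.
rewrite mulrSr addrA; split=> [|m mn|_]; first exact: positive_shift.
  by rewrite N_shift_other // P2.
exact: N_shift_self.
Qed.

(** Only the last shift in a direction matters: the other shifts preserve
    the value of [N] in this direction. *)
Lemma positive_comb l k (s : seq I) : positive l -> uniq s ->
  let l' := l + \sum_(n <- s) v n *+ k n in
  [/\ positive l', forall m, m \notin s -> N l' m = N l m
    & forall m, m \in s -> (0 < k m)%N -> 0 <= N l' m].
Proof.
elim: s l => [|n s IH] l Pl /=; first by rewrite big_nil addr0.
move=> /andP[ns us]; have [P1 P2 P3] := shift_many n (k n) Pl.
have [Q1 Q2 Q3] := IH _ P1 us; rewrite big_cons addrA; split=> // m.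
  by rewrite inE negb_or => /andP[mn ms]; rewrite Q2 // P2.
by rewrite inE => /orP[/eqP -> kn|]; [rewrite Q2 // P3 | exact: Q3].
Qed.

Lemma Nb_comb l k (s : seq I) m :
  Nb (l + \sum_(n <- s) v n *+ k n) m
    = Nb l m + \sum_(n <- s) (m == n)%:R * mu n * (k n)%:R.
Proof.
elim: s l => [|n s IH] l; first by rewrite !big_nil !addr0.
rewrite !big_cons addrA IH addrA; congr (_ + _).
elim: (k n) => [|j IHj]; first by rewrite mulr0n mulr0 !addr0.
by rewrite mulrSr addrA Nb_shift IHj -[j.+1]addn1 natrD; ring.
Qed.

Lemma Z_comb l k (s : seq I) : Z (l + \sum_(n <- s) v n *+ k n) <-> Z l.
Proof.
elim: s l => [|n s IH] l; first by rewrite big_nil addr0.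
rewrite big_cons addrA IH; elim: (k n) => [|j IHj]; first by rewrite addr0.
by rewrite mulrSr addrA Z_shift.
Qed.

Lemma Nb_face l k A m :
  Nb (l + \sum_(n in A) v n *+ k n) m
    = Nb l m + mu m * (if m \in A then k m else 0%N)%:R.
Proof.
rewrite -big_enum Nb_comb big_enum /=; congr (_ + _).
case: ifP => mA.
  rewrite (bigD1 m) //= eqxx mul1r big1 ?addr0 // => n /andP[_ nm].
  by rewrite eq_sym (negPf nm) !mul0r.
rewrite mulr0 big1 // => n nA; case: eqP => [E|_]; last by rewrite !mul0r.
by rewrite E nA in mA.
Qed.

Lemma reduced_positive l : reduced l -> positive l.
Proof. by move=> [Zl h]; split=> // m; have /andP[] := h m. Qed.

(** The number of copies of [v n] to remove is the quotient of [Nb l n] by [mu n].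
    A positive quotient for [n] in [J] would force [N l n] to be nonnegative, so only
    directions outside [J] occur. *)
Lemma face_holes J l :
  (positive l /\ forall n, n \in J -> N l n < 0) <->
  exists2 l0, reduced l0 /\ (forall n, n \in J -> N l0 n < 0) &
    exists k : {ffun I -> nat}, l = l0 + \sum_(n in ~: J) v n *+ k n.
Proof.
split=> [[Pl Nl]|[l0 [rl0 Nl0] [k ->]]]; last first.
  have [P1 P2 _] := positive_comb k (reduced_positive rl0) (enum_uniq (~: J)).
  rewrite big_enum in P1 P2; split=> // n nJ; rewrite P2 ?Nl0 //.
  by rewrite mem_enum finset.in_setC nJ.
pose k := [ffun n => Num.trunc (Nb l n / mu n)].
pose l0 := l - \sum_n v n *+ k n.
have lE : l = l0 + \sum_(n in [set: I]%SET) v n *+ k n.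
  by rewrite /l0 [X in _ + X](eq_bigl xpredT) ?subrK // => n; rewrite finset.in_setT.
have rl0 : reduced l0.
  have [Zl Nbl] := Pl; split.
    by apply/(Z_comb l0 k (enum [set: I]%SET)); rewrite big_enum -lE.
  move=> m; have := Nb_face l0 k [set: I]%SET m; rewrite -lE finset.in_setT => E.
  have q0 : 0 <= Nb l m / mu m by rewrite divr_ge0 ?Nbl // ltW.
  have /andP[] := Num.Theory.truncn_itv q0.
  rewrite ler_pdivlMr // ltr_pdivrMr // -natr1 mulrDl mul1r.
  move: E; rewrite ffunE; set t := (Num.trunc _)%:R => E h1 h2.
  by apply/andP; split; lra.
have [_ _ P3] := positive_comb k (reduced_positive rl0) (enum_uniq [set: I]%SET).
rewrite big_enum -lE in P3.
have k0 n : n \in J -> k n = 0%N.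
  move=> nJ; apply/eqP; rewrite -leqn0 leqNgt; apply/negP => kn.
  by have := Nl n nJ; rewrite ltNge P3 // mem_enum finset.in_setT.
have lE' : l = l0 + \sum_(n in ~: J) v n *+ k n.
  rewrite {1}lE; congr (_ + _); rewrite [LHS](bigID (mem J)) /= big1 ?add0r.
    by apply: eq_bigl => n; rewrite finset.in_setT finset.in_setC.
  by move=> n /andP[_ nJ]; rewrite k0.
exists l0; last by exists k.
split=> // n nJ.
have [_ P2 _] := positive_comb k (reduced_positive rl0) (enum_uniq (~: J)).
rewrite big_enum -lE' in P2; rewrite -P2 ?Nl // mem_enum finset.in_setC nJ //.
Qed.

(** The values of [Nb] determine the multiplicities, as quotients in a division
    by [mu]. *)
Lemma reduced_unique A l l' (k k' : I -> nat) : reduced l -> reduced l' ->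
  l + \sum_(n in A) v n *+ k n = l' + \sum_(n in A) v n *+ k' n -> l = l'.
Proof.
move=> [_ rl] [_ rl'].
have key (x y c : R) (i j : nat) : 0 <= x < c -> 0 <= y < c ->
    x + c * i%:R = y + c * j%:R -> (i <= j)%N.
  move=> /andP[x0 xc] /andP[y0 yc] e; rewrite leqNgt; apply/negP => ij.
  have : j%:R + 1 <= i%:R :> R by rewrite natr1 ler_nat.
  rewrite -(ler_pM2l (le_lt_trans x0 xc)) mulrDr mulr1 => h; lra.
move=> E; have kk n : n \in A -> k n = k' n.
  move=> nA; have := Nb_face l k A n; rewrite E Nb_face nA => e.
  apply/eqP; rewrite eqn_leq (key _ _ _ _ _ (rl n) (rl' n)) //.
  by rewrite (key _ _ _ _ _ (rl' n) (rl n)).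
move: E; rewrite (eq_bigr (fun n => v n *+ k' n)) => [|n nA]; last by rewrite kk.
exact: addIr.
Qed.

End FundamentalDomain.

(** * The orbifold cone and admissible vectors *)

Section OrbifoldCone.
Variables (R : realType) (G : plumbing_graph).
Hypothesis acy : acyclic G.
Hypothesis conn : connected_graph G.
Hypothesis neg : negative_definite G.
Variable ord : rel (node G).
Implicit Types (n m : node G) (l : {ffun node G -> int}).
Local Notation orb_form := (@orb_form R G).

Lemma orb_form_comb (J : finType) (c : J -> R) (x : J -> {ffun node G -> R}) n :
  orb_form n [ffun m => \sum_j c j * x j m] = \sum_j c j * orb_form n (x j).
Proof.
have -> : [ffun m => \sum_j c j * x j m] = \sum_j [ffun m => c j * x j m].
  by apply/ffunP => m; rewrite sum_ffunE ffunE; apply: eq_bigr => j _; rewrite ffunE.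
rewrite (big_morph (orb_form n) (id1 := 0) (op1 := +%R)).
- by apply: eq_bigr => j _; exact: orb_formZ.
- by move=> y z; exact: orb_formD.
- by apply: (addrI (orb_form n 0)); rewrite -orb_formD !addr0.
Qed.

Definition node_lift n : reduced_lift G :=
  ReducedLift (fun m => (m == n)%:R) (fun=> 0) (fun _ _ => 0).

Lemma Nbar_node_only a n :
    (forall u, rl_leaf a u = 0) -> (forall m m', rl_edge a m m' = 0) ->
  Nbar_fun R ord a 0 n = (rl_node a n)%:~R.
Proof.
move=> a1 a2; rewrite Nbar_base /N_base.
have z0 m : fun_of_fin (0 : {ffun node G -> int}) m = 0 by rewrite ffunE.
rewrite z0 mulr0 big1 => [|m _]; last by rewrite a2 mulr0.
rewrite big1 => [|m _]; last by rewrite a2 mulr0.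
rewrite big1 => [|m _]; last by rewrite z0 mul0r.
rewrite big1 => [|u _]; first by rewrite !subr0 !addr0.
by rewrite /leaf_quot a1 z0 mulr0 subr0 mul0r.
Qed.

Lemma orb_form_node_lift n m : orb_form m (c_vec R ord (node_lift n)) = (m == n)%:R.
Proof. by rewrite orb_form_c_vec // Nbar_node_only //=; case: (m == n). Qed.

(** The vector is the projection of E*_n, which is in the Lipman cone. *)
Lemma node_lift_cone n : C_orb (c_vec R ord (node_lift n)).
Proof.
exists (lift_vec R ord (node_lift n)) => // w.
rewrite pairing_lift_vec // oppr_le0 /lift_coef /edge_coef.
rewrite !addr_ge0 // sumr_ge0 // => m _ /=; by rewrite ler0z.
Qed.

(** The vectors dual to the forms give a one-sided inverse of the matrix of the
    forms, hence a two-sided one. *)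
Lemma orb_form_inj (y : {ffun node G -> R}) : (forall n, orb_form n y = 0) -> y = 0.
Proof.
move=> y0.
(* [A] lists the dual vectors, [B] the values of the forms on the standard basis. *)
pose unit m : {ffun node G -> R} := [ffun m' => (m == m')%:R].
have yE (z : {ffun node G -> R}) : z = [ffun m => \sum_j z j * unit j m].
  apply/ffunP => m; rewrite ffunE (bigD1 m) //= ffunE eqxx mulr1 big1 ?addr0 //.
  by move=> j jm; rewrite ffunE (negPf jm) mulr0.
pose e k := c_vec R ord (node_lift k).
pose A : 'M[R]_#|{: node G}| := \matrix_(i, j) e (enum_val i) (enum_val j).
pose B : 'M[R]_#|{: node G}| := \matrix_(i, j) orb_form (enum_val j) (unit (enum_val i)).
have sumE (z : {ffun node G -> R}) k :
    \sum_(j < #|{: node G}|) z (enum_val j) * orb_form k (unit (enum_val j)) = orb_form k z.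
  rewrite [in RHS](yE z) orb_form_comb.
  rewrite [RHS](reindex (fun i : 'I_#|{: node G}| => enum_val i)) //=.
  by exists enum_rank => i _; rewrite ?enum_valK ?enum_rankK.
have AB : A *m B = 1%:M.
  apply/matrixP => i k; rewrite !mxE; under eq_bigr => j _ do rewrite !mxE.
  by rewrite sumE orb_form_node_lift (inj_eq enum_val_inj) eq_sym.
pose Y : 'rV[R]_#|{: node G}| := \row_j y (enum_val j).
have YB : Y *m B = 0.
  apply/rowP => k; rewrite !mxE.
  by under eq_bigr => j _ do rewrite !mxE; rewrite sumE y0.
have Y0 : Y = 0 by rewrite -[Y]mulmx1 -(mulmx1C AB) mulmxA YB mul0mx.
apply/ffunP => m; have := congr1 (fun M : 'rV[R]__ => M 0 (enum_rank m)) Y0.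
by rewrite !mxE enum_rankK ffunE.
Qed.

Lemma toRD l l' : toR R (l + l') = toR R l + toR R l'.
Proof. by apply/ffunP => m; rewrite !ffunE intrD. Qed.

Lemma Nbar_shift a l l' n :
  Nbar_fun R ord a (l + l') n = Nbar_fun R ord a l n + orb_form n (toR R l').
Proof. by rewrite !Nbar_orb_form // toRD addrAC; exact: orb_formD. Qed.

Lemma fract_itv (x : R) : 0 <= fract x < 1.
Proof.
have /andP[h1 h2] := floor_itv x; rewrite /fract subr_ge0 h1 ltrBlDr.
by move: h2; rewrite rmorphD /= addrC.
Qed.

Lemma N_le_Nbar a l n : N_fun R ord a l n <= Nbar_fun R ord a l n.
Proof.
rewrite /Nbar_fun lerDl sumr_ge0 // => u _.
by have /andP[] := fract_itv (leaf_quot R a l n u).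
Qed.

Lemma Nbar_le_N a l n : Nbar_fun R ord a l n <= N_fun R ord a l n + #|{: leaf G}|%:R.
Proof.
rewrite /Nbar_fun lerD2l -sum1_card natr_sum [leRHS](bigID (leaf_of n)) /=.
rewrite ler_wpDr ?sumr_ge0 //; apply: ler_sum => u _.
by have /andP[_ /ltW] := fract_itv (leaf_quot R a l n u).
Qed.

(** The congruences for the zero lift are the homogeneous ones. *)
Lemma ZN_shift a l l' : ZN ord (zero_lift G) l' -> ZN ord a (l + l') <-> ZN ord a l.
Proof.
move=> Zl'; suff H n n' : nlt ord n n' ->
    ((l + l')%R n + omega n' n * (l + l')%R n' == rl_edge a n n' %[mod alpha n n'])%Z
    = (l n + omega n' n * l n' == rl_edge a n n' %[mod alpha n n'])%Z.
  by split=> Zl n n' nn'; apply/eqP; [rewrite -H | rewrite H] => //; apply/eqP/Zl.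
move=> nn'; have /eqP := Zl' n n' nn'; rewrite !eqz_mod_dvd /= subr0 !ffunE => d.
rewrite -[RHS](rpredDr _ d); congr (in_mem _ _); ring.
Qed.

Section Admissible.
Variables (a : reduced_lift G) (kappa : R) (v : node G -> {ffun node G -> int}).
Hypothesis kappa_ge0 : 0 <= kappa.
Hypothesis adm : admissible ord a kappa v.
Local Notation pos := (Mbar_set R ord a).
Local Notation N := (N_fun R ord a).
Local Notation Nb := (Nbar_fun R ord a).
Local Notation mu n := (orb_form n (toR R (v n))).

Lemma ZN_admissible l n : ZN ord a (l + v n) <-> ZN ord a l.
Proof. by apply: ZN_shift; case: adm => /(_ n) []. Qed.

Lemma orb_form_v_ge0 n m : 0 <= orb_form m (toR R (v n)).
Proof.
have [/(_ n) [_ /(_ m) h] _ _] := adm.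
apply: le_trans h _; apply: le_trans (N_le_Nbar _ _ _) _.
by rewrite Nbar_toR Nbar_node_only //= add0r.
Qed.

Lemma orb_form_real_comb c n :
  orb_form n (real_comb v c) = \sum_m c m * orb_form n (toR R (v m)).
Proof.
rewrite -orb_form_comb; congr (orb_form n _); apply/ffunP => m; rewrite !ffunE.
by apply: eq_bigr => j _; rewrite ffunE.
Qed.

(** Otherwise the form would vanish on the whole cone generated by the [v n],
    which contains the projection of E*_m. *)
Lemma orb_form_v_sum_gt0 m : 0 < \sum_n orb_form m (toR R (v n)).
Proof.
have [_ cone _] := adm; have := node_lift_cone m; rewrite -cone => -[c c0 E].
have := orb_form_node_lift m m; rewrite -E orb_form_real_comb eqxx => s1.
rewrite lt_neqAle sumr_ge0 ?andbT; last by move=> n _; exact: orb_form_v_ge0.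
apply/negP; rewrite eq_sym psumr_eq0 => [/allP z|n _]; last exact: orb_form_v_ge0.
suff : 0 = 1 :> R by move/eqP; rewrite eq_sym oner_eq0.
rewrite -[RHS]s1 big1 // => n _.
by have /eqP -> := z n (mem_index_enum n); rewrite mulr0.
Qed.

Lemma Mbar_shift l n : pos l -> pos (l + v n).
Proof.
move=> [Zl Nl]; split=> [|m]; first exact/ZN_admissible.
by rewrite Nbar_shift addr_ge0 // orb_form_v_ge0.
Qed.

(** Adding many copies of the sum of all [v n] makes all values positive. *)
Lemma Mbar_nonempty l : ZN ord a l -> exists l', pos l'.
Proof.
move=> Zl; pose S m := \sum_n orb_form m (toR R (v n)).
(* Enough copies to outweigh every negative value at once. *)
pose t := Num.Def.archi_bound (\sum_m `|Nb l m| / S m).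
have s0 m : 0 <= `|Nb l m| / S m by rewrite divr_ge0 // ltW // orb_form_v_sum_gt0.
have tP : \sum_m `|Nb l m| / S m < t%:R by rewrite archi_boundP // sumr_ge0.
have E j : ZN ord a (l + (\sum_n v n) *+ j) /\
    forall m, Nb (l + (\sum_n v n) *+ j) m = Nb l m + S m * j%:R.
  elim: j => [|j [Z1 N1]]; first by rewrite addr0; split=> // m; rewrite mulr0 addr0.
  have step l1 (s : seq (node G)) : ZN ord a l1 -> ZN ord a (l1 + \sum_(n <- s) v n) /\
      forall m, Nb (l1 + \sum_(n <- s) v n) m
        = Nb l1 m + \sum_(n <- s) orb_form m (toR R (v n)).
    elim: s l1 => [|n s IH] l1 Z0.
      by rewrite !big_nil addr0; split=> // m; rewrite big_nil addr0.
    rewrite big_cons addrA; have [] := IH (l1 + v n); first exact/ZN_admissible.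
    by move=> h1 h2; split=> // m; rewrite big_cons h2 Nbar_shift -addrA.
  rewrite mulrSr addrA; have [h1 h2] := step _ (index_enum (node G)) Z1.
  by split=> // m; rewrite h2 N1 -[j.+1]addn1 natrD /S; ring.
have [h1 h2] := E t; exists (l + (\sum_n v n) *+ t); split=> // m; rewrite h2.
have : `|Nb l m| / S m < t%:R.
  by apply: le_lt_trans tP; rewrite (bigD1 m) //= lerDl sumr_ge0.
rewrite ltr_pdivrMr ?orb_form_v_sum_gt0 // mulrC => h.
have := ler_norm (- Nb l m); rewrite normrN; lra.
Qed.

(** A positive value would make the normalized function grow without bound along
    the shifts by [v n], while the counting function stays constant and the two
    differ by at most the number of ends. *)
Lemma orb_form_v_other l n m : pos l -> m != n -> orb_form m (toR R (v n)) = 0.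
Proof.
move=> Pl mn; apply/eqP; rewrite eq_le orb_form_v_ge0 andbT leNgt; apply/negP => c0.
have [_ _ h] := adm.
have E j : [/\ pos (l + v n *+ j), N (l + v n *+ j) m = N l m &
    Nb (l + v n *+ j) m = Nb l m + orb_form m (toR R (v n)) * j%:R].
  elim: j => [|j [P1 N1 E1]]; first by rewrite mulr0n !addr0 mulr0 addr0.
  rewrite mulrSr addrA; split; first exact: Mbar_shift.
    by rewrite -N1; apply: (h _ n P1).1.
  by rewrite Nbar_shift E1 -[j.+1]addn1 natrD; ring.
(* After more than [b] shifts the two functions are too far apart. *)
pose b := (N l m + #|{: leaf G}|%:R - Nb l m) / orb_form m (toR R (v n)).
have b0 : 0 <= b by rewrite divr_ge0 ?(ltW c0) // subr_ge0 Nbar_le_N.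
have := archi_boundP b0; set j := Num.Def.archi_bound b.
have [_ E1 E2] := E j; have := Nbar_le_N a (l + v n *+ j) m; rewrite E1 E2.
by rewrite /b ltr_pdivrMr // mulrC => h1 h2; lra.
Qed.

Lemma mu_gt0 l n : pos l -> 0 < mu n.
Proof.
move=> Pl; have := orb_form_v_sum_gt0 n; rewrite (bigD1 n) //= big1 ?addr0 // => m mn.
by rewrite (orb_form_v_other Pl) // eq_sym.
Qed.

Lemma box_itv l y : pos l ->
  box v y <-> forall n, 0 <= orb_form n y < mu n.
Proof.
move=> Pl.
have orb_form_comb_v c n : orb_form n (real_comb v c) = c n * mu n.
  rewrite orb_form_real_comb (bigD1 n) //= big1 ?addr0 // => m mn.
  by rewrite (orb_form_v_other Pl) ?mulr0 // eq_sym.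
split=> [[c c01 <-] n|h].
  have /andP[c0 c1] := c01 n; rewrite orb_form_comb_v mulr_ge0 ?(ltW (mu_gt0 n Pl)) //=.
  by rewrite -[ltRHS]mul1r ltr_pM2r // (mu_gt0 n Pl).
exists [ffun n => orb_form n y / mu n].
  move=> n; rewrite ffunE; have /andP[y0 y1] := h n.
  by rewrite divr_ge0 ?(ltW (mu_gt0 n Pl)) //= ltr_pdivrMr ?mul1r // (mu_gt0 n Pl).
apply/eqP; rewrite -subr_eq0; apply/eqP; apply: orb_form_inj => n.
have -> : real_comb v [ffun n0 => orb_form n0 y / mu n0] - y =
   real_comb v [ffun n0 => orb_form n0 y / mu n0] + [ffun m => -1 * y m].
  by apply/ffunP => m; rewrite !ffunE; ring.
rewrite orb_formD orb_formZ orb_form_comb_v ffunE divfK ?mulN1r ?subrr //.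
by rewrite gt_eqF // (mu_gt0 n Pl).
Qed.

Local Open Scope classical_set_scope.

(** The translates cover the set by division with remainder, and they are disjoint
    because the remainder is unique. *)
Lemma M_minus_faces (J : {set node G}) :
  is_disjoint_union [set l | pos l /\ forall n, n \in J -> N l n < 0]
    (M_minus R ord a v J) (fun l => translate l (F_face v J)).
Proof.
have [[l1 Z1]|noZ] := pselect (exists l, ZN ord a l); last first.
  split=> [|l l' [Zl _ _]]; last by case: noZ; exists l.
  rewrite predeqE => l; split=> [[[Zl _] _]|[l' [Zl _ _]]]; first by case: noZ; exists l.
  by case: noZ; exists l'.
have [l0 P0] := Mbar_nonempty Z1.
have Nbs l n m : Nb (l + v n) m = Nb l m + (m == n)%:R * mu n.
  rewrite Nbar_shift; case: eqP => [->|/eqP mn]; first by rewrite mul1r.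
  by rewrite (orb_form_v_other P0) // mul0r.
have mu0 n : 0 < mu n := mu_gt0 n P0.
have [_ _ h] := adm.
have Nso l n m : pos l -> m != n -> N (l + v n) m = N l m.
  by move=> Pl; apply: (h l n Pl).1.
have Nss l n : pos l -> 0 <= N (l + v n) n.
  by move=> Pl; apply: le_trans kappa_ge0 (h l n Pl).2.
have MmE l : M_minus R ord a v J l <->
    reduced (ZN ord a) Nb (fun n => mu n) l /\ forall n, n \in J -> N l n < 0.
  split=> [[Zl /(box_itv _ P0) bl Nl]|[[Zl bl] Nl]].
    by split=> //; split=> // n; rewrite Nbar_orb_form.
  by split=> //; apply/(box_itv _ P0) => n; rewrite -Nbar_orb_form.
split.
  rewrite predeqE => l; split.
    move/(face_holes mu0 ZN_admissible Nbs Nso Nss) => [l' rl' [k ->]].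
    by exists l'; [exact/MmE | exists (\sum_(n in ~: J) v n *+ k n) => //; exists k].
  move=> [l' /MmE rl' [_ [k _ <-] <-]].
  by apply/(face_holes mu0 ZN_admissible Nbs Nso Nss); exists l' => //; exists k.
move=> l l' /MmE [rl _] /MmE [rl' _] [_ [[_ [k _ <-] <-] [_ [k' _ <-] E]]].
exact: (reduced_unique Nbs rl rl' (esym E)).
Qed.

End Admissible.
End OrbifoldCone.

(** * The decomposition *)

Local Open Scope classical_set_scope.

Theorem proposition4p1p3 (R : realType) (G : plumbing_graph)
    (hconn : connected_graph G) (hacyc : acyclic G)
    (hneg : negative_definite G) (hmin : minimal_good G)
    (hnodes : (0 < #|{: node G}|)%N)
    (ord : rel (node G)) (hord : pair_ordering ord)
    (a : reduced_lift G) (kappa : R) (hkappa : 0 <= kappa)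
    (v : node G -> {ffun node G -> int})
    (hadm : admissible ord a kappa v) :
  is_disjoint_union (Mbar_set R ord a) (M_minus R ord a v finset.set0)
    (fun l => translate l (nat_span v [set: node G]%SET))
  /\
  ((Mbar_set R ord a `\` M_set R ord a =
      \bigcup_(n in [set: node G])
        \bigcup_(l in M_minus R ord a v [set n]%SET)
          translate l (F_face v [set n]%SET)
    /\ forall n : node G, trivIset (M_minus R ord a v [set n]%SET)
         (fun l => translate l (F_face v [set n]%SET)))
   /\
   forall I : {set node G}, I != finset.set0 ->
     is_disjoint_union
       (\bigcap_(n in [set` I])
          \bigcup_(l in M_minus R ord a v [set n]%SET)
            translate l (F_face v [set n]%SET))
       (M_minus R ord a v I)
       (fun l => translate l (F_face v I))).
Proof.
have faces := M_minus_faces hacyc hconn hneg hkappa hadm.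
have holes n l : (\bigcup_(l in M_minus R ord a v [set n]%SET)
     translate l (F_face v [set n]%SET)) l <->
    Mbar_set R ord a l /\ N_fun R ord a l n < 0.
  rewrite -(faces [set n]%SET).1; split=> [[Pl Nl]|[Pl Nl]]; split=> //.
    by apply: Nl; rewrite finset.in_set1.
  by move=> m; rewrite finset.in_set1 => /eqP ->.
split; last split.
- have := faces finset.set0; rewrite /F_face finset.setC0 => -[E T]; split=> //.
  rewrite -E predeqE => l; split=> [Pl|[]//]; split=> // n.
  by rewrite finset.in_set0.
- split; last by move=> n; exact: (faces [set n]%SET).2.
  rewrite predeqE => l; split=> [[Pl nM]|[n _ /holes [Pl Nl]]].
    have [n /negP Nn] : exists n, ~ 0 <= N_fun R ord a l n.
      by apply/existsNP => N0; apply: nM; split=> //; case: Pl.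
    by exists n => //; apply/holes; split=> //; rewrite ltNge.
  by split=> // -[_ /(_ n)]; rewrite leNgt Nl.
- move=> I /set0Pn [n0 n0I]; split; last exact: (faces I).2.
  rewrite -(faces I).1 predeqE => l; split=> [h|[Pl Nl] n nI].
    split=> [|n nI]; first by have /holes [] := h n0 n0I.
    by have /holes [] := h n nI.
  by apply/holes; split=> //; exact: Nl.
Qed.
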